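(* Let $\alpha>0$ be real, and let $D^\alpha_x, D^\alpha_y$ denote the partial fractional derivatives of order $\alpha$ with lower limits $0$, according to either the Riemann-Liouville or the Caputo definition. Let $f(x,y)$ be a real analytic function, let $x'=\cos\phi\,x+\sin\phi\,y$, $y'=-\sin\phi\,x+\cos\phi\,y$ be the coordinates rotated by the angle $\phi$, and let $f'$ be the transformed function, $f'(x',y')=e^{\phi L}f(x,y)$. Then, on the domain where $x,y>0$ and $y/x>\tan\phi$ (so that also $x',y'>0$), the partial fractional derivatives of $f$ transform as $$D^\alpha_{x'}f'(x',y')=e^{\phi L}\,D^\alpha_x f(x,y),\qquad D^\alpha_{y'}f'(x',y')=e^{\phi L}\,D^\alpha_y f(x,y).$$ In the infinitesimal angle approximation, $\phi\ll1$, keeping only terms linear in $\phi$, $$D^\alpha_{x'}f'(x',y')\approx D^\alpha_xf(x,y)+\phi\,L\,D^\alpha_xf(x,y),\qquad D^\alpha_{y'}f'(x',y')\approx D^\alpha_yf(x,y)+\phi\,L\,D^\alpha_yf(x,y).$$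
   Context: Functions are real functions of the Cartesian coordinates $(x,y)$ of $\mathbb{R}^2$, analytic in a specific domain. For $n-1<\alpha<n$, $n\in\mathbb{N}$, the Riemann-Liouville partial fractional derivatives are $$D_x^\alpha f(x,y)=\frac{1}{\Gamma(n-\alpha)}\frac{\partial^n}{\partial x^n}\int_0^x\frac{f(u,y)\,du}{(x-u)^{\alpha-n+1}},\qquad D_y^\alpha f(x,y)=\frac{1}{\Gamma(n-\alpha)}\frac{\partial^n}{\partial y^n}\int_0^y\frac{f(x,u)\,du}{(y-u)^{\alpha-n+1}},$$ and the Caputo partial fractional derivatives are $${}^{C}D_x^\alpha f(x,y)=\frac{1}{\Gamma(n-\alpha)}\int_0^x\frac{\partial_u^n f(u,y)\,du}{(x-u)^{\alpha-n+1}},\qquad {}^{C}D_y^\alpha f(x,y)=\frac{1}{\Gamma(n-\alpha)}\int_0^y\frac{\partial_u^n f(x,u)\,du}{(y-u)^{\alpha-n+1}}.$$ For integer $\alpha=n$ they are the ordinary partial derivatives $D^n_x=\partial^n/\partial x^n$, $D^n_y=\partial^n/\partial y^n$. The generator of rotations is $L=y\,D^1_x-x\,D^1_y$, and the exponential is defined as the infinite sum of differential operators $e^{\phi L}=\sum_{n=0}^\infty\frac{\phi^n}{n!}L^n$. The dependence of the function on the rotation angle $\phi$ comes only through its arguments; under this assumption the transformed function satisfies $f'(x',y')=e^{\phi L}f(x,y)$. The expression $D^\alpha_{x'}f'(x',y')$ is the fractional derivative of $f'$ with respect to its first argument $x'$, with $y'$ held constant and lower limit $x'=0$; $D^\alpha_{y'}f'(x',y')$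 is the one with respect to the second argument $y'$, with $x'$ held constant and lower limit $y'=0$.
   Formalization: The finite-angle law assumes the series e^{φL}f (near the integration path) and e^{φL}D^αf converge, |φ|<π/2, x'>0, and f analytic on the points swept by the rotation; for f=1 (Riemann-Liouville, 0<α<1) the series can diverge. Convergence is proved for small φ. *)

(* Defs.v *)
From Stdlib Require Import Reals Factorial.
From Coquelicot Require Import Coquelicot.
Open Scope R_scope.

(** Real analyticity in two variables: near (a, b), f is the sum of an
    absolutely convergent double power series, summed here by total degree. *)
Definition analytic_at (f : R -> R -> R) (a b : R) : Prop :=
  exists (c : nat -> nat -> R) (r : posreal),
    forall h k : R, Rabs h < r -> Rabs k < r ->
      ex_series (fun n => sum_n (fun i => Rabs (c i (n - i)%nat * h ^ i * k ^ (n - i))) n) /\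
      is_series (fun n => sum_n (fun i => c i (n - i)%nat * h ^ i * k ^ (n - i)) n)
                (f (a + h) (b + k)).

Definition Gamma (z : R) : R :=
  RInt_gen (fun t => Rpower t (z - 1) * exp (- t)) (at_right 0) (Rbar_locally p_infty).

(** One-variable fractional derivatives with lower limit 0, for a point x > 0
    and n - 1 < alpha < n.  The kernel is singular at u = x, so the integrals
    are improper at their upper end. *)
Definition RL_deriv (n : nat) (alpha : R) (h : R -> R) (x : R) : R :=
  / Gamma (INR n - alpha) *
  Derive_n (fun z => RInt_gen (fun u => h u / Rpower (z - u) (alpha - INR n + 1))
                              (at_point 0) (at_left z)) n x.

Definition Caputo_deriv (n : nat) (alpha : R) (h : R -> R) (x : R) : R :=
  / Gamma (INR n - alpha) *
  RInt_gen (fun u => Derive_n h n u / Rpower (x - u) (alpha - INR n + 1))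
           (at_point 0) (at_left x).

Inductive frac_kind : Set := Riemann_Liouville | Caputo.

(** [up alpha] is the integer n with n - 1 <= alpha < n; the case
    alpha = n - 1 is the ordinary derivative of order n - 1. *)
Definition frac_deriv (kd : frac_kind) (alpha : R) (h : R -> R) (x : R) : R :=
  let n := Z.to_nat (up alpha) in
  if Req_EM_T alpha (INR (pred n)) then Derive_n h (pred n) x
  else match kd with
       | Riemann_Liouville => RL_deriv n alpha h x
       | Caputo => Caputo_deriv n alpha h x
       end.

Definition Dfrac_x (kd : frac_kind) (alpha : R) (f : R -> R -> R) (x y : R) : R :=
  frac_deriv kd alpha (fun u => f u y) x.

Definition Dfrac_y (kd : frac_kind) (alpha : R) (f : R -> R -> R) (x y : R) : R :=
  frac_deriv kd alpha (fun v => f x v) y.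

Definition rot_x (phi x y : R) : R := cos phi * x + sin phi * y.
Definition rot_y (phi x y : R) : R := - sin phi * x + cos phi * y.

Definition L_op (g : R -> R -> R) (x y : R) : R :=
  y * Derive (fun u => g u y) x - x * Derive (fun v => g x v) y.

Definition exp_L_term (phi : R) (g : R -> R -> R) (x y : R) (n : nat) : R :=
  phi ^ n / INR (fact n) * Nat.iter n L_op g x y.

Definition exp_L (phi : R) (g : R -> R -> R) (x y : R) : R :=
  Series (exp_L_term phi g x y).

(** [Series] is total, so convergence is a separate predicate. *)
Definition ex_exp_L (phi : R) (g : R -> R -> R) (x y : R) : Prop :=
  ex_series (exp_L_term phi g x y).

(** The series e^(phi L) f giving the value of the transformed function f' at
    the rotated point (X, Y) converges.  The series is based at the point
    whose rotation is (X, Y). *)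
Definition transform_converges (phi : R) (f : R -> R -> R) (X Y : R) : Prop :=
  ex_exp_L phi f (rot_x (- phi) X Y) (rot_y (- phi) X Y).

(** The transformed function is given by convergent series near every point
    of the path of integration of the fractional derivative at (x', y'),
    i.e. [0, x'] x {y'}, respectively {x'} x [0, y']. *)
Definition transform_converges_x (phi : R) (f : R -> R -> R) (x' y' : R) : Prop :=
  forall s : R, 0 <= s <= 1 ->
    locally (s * x') (fun X => transform_converges phi f X y').

Definition transform_converges_y (phi : R) (f : R -> R -> R) (x' y' : R) : Prop :=
  forall s : R, 0 <= s <= 1 ->
    locally (s * y') (fun Y => transform_converges phi f x' Y).

(** The domain U of f contains every point that a rotation by an angle between
    0 and phi requires: the path of integration of the fractional derivative
    at each intermediate position of (x, y), and each intermediate position of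
    the path of integration at the final point (x', y').  This always holds
    when U is the whole plane. *)
Definition rotation_domain_x (U : R * R -> Prop) (phi x y : R) : Prop :=
  forall s t : R, 0 <= s <= 1 -> 0 <= t <= 1 ->
    U (s * rot_x (t * phi) x y, rot_y (t * phi) x y) /\
    (let X := s * rot_x phi x y in
     let Y := rot_y phi x y in
     U (rot_x (- (t * phi)) X Y, rot_y (- (t * phi)) X Y)).

Definition rotation_domain_y (U : R * R -> Prop) (phi x y : R) : Prop :=
  forall s t : R, 0 <= s <= 1 -> 0 <= t <= 1 ->
    U (rot_x (t * phi) x y, s * rot_y (t * phi) x y) /\
    (let X := rot_x phi x y in
     let Y := s * rot_y phi x y in
     U (rot_x (- (t * phi)) X Y, rot_y (- (t * phi)) X Y)).

(* Main.v *)
Require Import Defs.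
From Stdlib Require Import Reals Lra Lia Factorial ZArith.
From Stdlib Require Import Classical ClassicalEpsilon.
From Stdlib Require Import FunctionalExtensionality PropExtensionality.
From Coquelicot Require Import Coquelicot.
Open Scope R_scope.

(** The operator L generates the rotations, so t |-> g (R_t p), with R_t the rotation
    by t, has n-th derivative (L^n g)(R_t p) and e^(phi L) g p is its Taylor series at 0.
    For analytic g a convergent Taylor series sums to g (R_phi p), by the identity theorem
    on [0, phi) and Abel's theorem at the end point.  Applied to f this gives f' = f near
    the path of integration; applied to D^alpha f it gives the transformation law, once
    D^alpha f is known to be analytic.  After the substitution u = z (1 - w^(1/beta)) the
    fractional integral of order beta becomes z^beta times a proper integral over [0, 1]
    of values of f at dilated points, which inherits the Cauchy estimates of f. *)

(** * Taylor series in one variable *)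

(** Convergence of e^(phi L) g at a point does not by itself determine the sum: a smooth function
    may have a convergent Taylor series with another sum. The link is a bound M n! K^n on the
    derivatives of t |-> g (R_t p), valid on the whole arc, which forces the difference of function
    and series to vanish by steps of fixed length. Such a bound has to survive L, partial
    derivatives, products with powers of x and integrals with a parameter, and coefficients of power
    series are awkward for the last. Hence analyticity is used as [regular]: near the point the
    partial derivatives of order (i, j) are at most M (i+j)! rho^(i+j). This weight treats both
    variables alike, and L^n raises it to (i+j+n)!. Most losses come from (n+k)! <= n! k! 2^(n+k)
    and are absorbed by doubling rho. A fractional derivative sees f along a whole segment, so the
    local estimates are made uniform by compactness, on segments and on arcs alike. The case of y is
    the case of x after reflection in the diagonal, which turns phi into -phi and L into -L. *)

Lemma INR_fact_pos (n : nat) : 0 < INR (fact n).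
Proof. apply INR_fact_lt_0. Qed.

Lemma INR_fact_S (n : nat) : INR (fact (S n)) = INR (S n) * INR (fact n).
Proof. now rewrite fact_simpl, mult_INR. Qed.

(* One term of the binomial expansion of [(1 + e) ^ (n + k)]. *)
Lemma fact_add_le (e : R) (n k : nat) : 0 <= e ->
  INR (fact (n + k)) * e ^ n <= INR (fact n) * INR (fact k) * (1 + e) ^ (n + k).
Proof.
  intros he.
  remember (n + k)%nat as N eqn:EN. revert n k EN.
  induction N as [|N IH]; intros n k EN.
  - assert (n = 0%nat) by lia; assert (k = 0%nat) by lia; subst; simpl; lra.
  (* The new factor N + 1 = n + k is split: the part n is paired with the summand [e] of [1 + e],
     the part k with the summand 1. *)
  - assert (hn : INR n * (INR (fact N) * e ^ n)
                 <= e * (INR (fact n) * INR (fact k) * (1 + e) ^ N)).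
    { destruct n as [|n].
      - simpl INR. rewrite Rmult_0_l.
        apply Rmult_le_pos; [easy|].
        repeat apply Rmult_le_pos; try apply pow_le; try lra; apply Rlt_le, INR_fact_pos.
      - assert (h := IH n k ltac:(lia)).
        rewrite INR_fact_S.
        replace (INR (S n) * (INR (fact N) * e ^ S n))
          with (INR (S n) * e * (INR (fact N) * e ^ n)) by (simpl; ring).
        replace (e * (INR (S n) * INR (fact n) * INR (fact k) * (1 + e) ^ N))
          with (INR (S n) * e * (INR (fact n) * INR (fact k) * (1 + e) ^ N)) by ring.
        apply Rmult_le_compat_l; [|exact h].
        apply Rmult_le_pos; [apply pos_INR|easy]. }
    assert (hk : INR k * (INR (fact N) * e ^ n)
                 <= INR (fact n) * INR (fact k) * (1 + e) ^ N).
    { destruct k as [|k].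
      - simpl INR. rewrite Rmult_0_l.
        repeat apply Rmult_le_pos; try apply pow_le; try lra; apply Rlt_le, INR_fact_pos.
      - assert (h := IH n k ltac:(lia)).
        rewrite (INR_fact_S k).
        replace (INR (fact n) * (INR (S k) * INR (fact k)) * (1 + e) ^ N)
          with (INR (S k) * (INR (fact n) * INR (fact k) * (1 + e) ^ N)) by ring.
        apply Rmult_le_compat_l; [apply pos_INR|exact h]. }
    rewrite INR_fact_S. simpl pow.
    replace (INR (S N)) with (INR n + INR k) by (rewrite EN; symmetry; apply plus_INR).
    lra.
Qed.

Lemma fact_mult_le (n k : nat) : INR (fact n) * INR (fact k) <= INR (fact (n + k)).
Proof.
  induction n as [|n IH]; [simpl; lra|].
  change (S n + k)%nat with (S (n + k)). rewrite !INR_fact_S.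
  assert (INR (S n) <= INR (S (n + k))) by (apply le_INR; lia).
  assert (h := INR_fact_pos n). assert (h' := INR_fact_pos k).
  rewrite Rmult_assoc. apply Rmult_le_compat; try easy.
  - apply pos_INR.
  - nra.
Qed.

Lemma is_derive_increasing (f df : R -> R) (a b : R) : a <= b ->
  (forall t, a <= t <= b -> is_derive f t (df t)) ->
  (forall t, a <= t <= b -> 0 <= df t) -> f a <= f b.
Proof.
  intros hab hd hp.
  destruct (MVT_gen f a b df) as [c [hc e]].
  - intros t; rewrite Rmin_left, Rmax_right by easy. intros; apply hd; lra.
  - intros t; rewrite Rmin_left, Rmax_right by easy. intros.
    apply derivable_continuous_pt. exists (df t). apply is_derive_Reals, hd; lra.
  - rewrite Rmin_left, Rmax_right in hc by easy.
    assert (h := hp c hc). nra.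
Qed.

Lemma is_derive_pow_fact (a t : R) (m : nat) (B : R) :
  is_derive (fun u => B * (u - a) ^ S m / INR (fact (S m))) t
            (B * (t - a) ^ m / INR (fact m)).
Proof.
  assert (h := INR_fact_pos m). assert (hS : 0 < INR (S m)) by (apply lt_0_INR; lia).
  rewrite INR_fact_S. generalize dependent (INR (fact m)). intros c hc.
  auto_derive; [easy|].
  change (Nat.pred (S m)) with m. fold (INR (S m)). unfold Rminus. field.
  split; apply Rgt_not_eq; assumption.
Qed.

(** The primitive of the bound, plus or minus [f], is increasing and vanishes at [a]. *)
Lemma abs_le_pow_of_derive (f df : R -> R) (a b B : R) (m : nat) :
  (forall t, a <= t <= b -> is_derive f t (df t)) ->
  (forall t, a <= t <= b -> Rabs (df t) <= B * (t - a) ^ m / INR (fact m)) ->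
  f a = 0 ->
  forall t, a <= t <= b -> Rabs (f t) <= B * (t - a) ^ S m / INR (fact (S m)).
Proof.
  intros hd hb h0 t ht.
  assert (z : B * (a - a) ^ S m / INR (fact (S m)) = 0).
  { rewrite Rminus_diag. simpl pow. unfold Rdiv. ring. }
  apply Rabs_le; split.
  - assert (h := is_derive_increasing
      (fun u => f u + B * (u - a) ^ S m / INR (fact (S m)))
      (fun u => df u + B * (u - a) ^ m / INR (fact m)) a t (proj1 ht)).
    cbv beta in h. rewrite z, h0 in h.
    enough (0 + 0 <= f t + B * (t - a) ^ S m / INR (fact (S m))) by lra.
    apply h.
    + intros u hu. apply @is_derive_plus; [apply hd; lra|apply is_derive_pow_fact].
    + intros u hu. assert (hh := hb u ltac:(lra)). apply Rabs_le_between in hh. lra.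
  - assert (h := is_derive_increasing
      (fun u => B * (u - a) ^ S m / INR (fact (S m)) - f u)
      (fun u => B * (u - a) ^ m / INR (fact m) - df u) a t (proj1 ht)).
    cbv beta in h. rewrite z, h0 in h.
    enough (0 - 0 <= B * (t - a) ^ S m / INR (fact (S m)) - f t) by lra.
    apply h.
    + intros u hu. apply @is_derive_minus; [apply is_derive_pow_fact|apply hd; lra].
    + intros u hu. assert (hh := hb u ltac:(lra)). apply Rabs_le_between in hh. lra.
Qed.

(** Taylor's formula without a polynomial part, because every derivative vanishes at [a]: the bound
    on the derivative of order n + N is integrated N times. *)
Lemma taylor_remainder_le (D : nat -> R -> R) (a b B : R) (N : nat) :
  (forall n t, a <= t <= b -> is_derive (D n) t (D (S n) t)) ->
  (forall n, D n a = 0) ->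
  forall n, (forall t, a <= t <= b -> Rabs (D (n + N)%nat t) <= B) ->
  forall t, a <= t <= b -> Rabs (D n t) <= B * (t - a) ^ N / INR (fact N).
Proof.
  intros hd h0. induction N as [|N IH]; intros n hB t ht.
  - simpl. rewrite <- (Nat.add_0_r n). eapply Rle_trans; [now apply hB|]. lra.
  - apply abs_le_pow_of_derive with (df := D (S n)) (b := b); auto.
    intros u hu. apply IH; [|easy].
    intros v hv. replace (S n + N)%nat with (n + S N)%nat by lia. auto.
Qed.

Lemma le_zero_of_geometric (a A : R) : (forall N, a <= A * (1 / 2) ^ N) -> a <= 0.
Proof.
  intros h. apply Rnot_lt_le; intros ha.
  assert (hA : 0 < A) by (assert (h0 := h 0%nat); simpl in h0; lra).
  destruct (pow_lt_1_zero (1 / 2) ltac:(rewrite Rabs_pos_eq; lra) (a / A)) as [N hN].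
  { now apply Rdiv_lt_0_compat. }
  assert (h1 := hN N ltac:(lia)). assert (h2 := h N).
  rewrite Rabs_pos_eq in h1 by (apply pow_le; lra).
  apply (Rmult_lt_compat_l A) in h1; [|easy].
  replace (A * (a / A)) with a in h1 by (field; lra). lra.
Qed.

(** A one-sided identity theorem. The estimates bound the radius of convergence from below by the
    same number at every point, so vanishing of all derivatives spreads by steps of constant length
    and reaches [r] after finitely many. *)
Lemma flat_cauchy_zero (D : nat -> R -> R) (r M K : R) : 0 < K -> 0 <= M ->
  (forall n t, 0 <= t <= r -> is_derive (D n) t (D (S n) t)) ->
  (forall n, D n 0 = 0) ->
  (forall n t, 0 <= t <= r -> Rabs (D n t) <= M * INR (fact n) * K ^ n) ->
  forall n t, 0 <= t <= r -> D n t = 0.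
Proof.
  intros hK hM hd h0 hb.
  (* With steps of length 1/(4K) the remainder of order N is a multiple of (2K/(4K))^N = (1/2)^N;
     the 2 comes from [fact_add_le] with [e = 1]. *)
  assert (hs : 0 < / (4 * K)) by (apply Rinv_0_lt_compat; lra).
  assert (main : forall m n t, 0 <= t <= r -> t <= INR m * / (4 * K) -> D n t = 0).
  { induction m as [|m IH]; intros n t ht htm.
    - simpl in htm. replace t with 0 by lra. apply h0.
    - rewrite S_INR in htm.
      destruct (Rle_dec t (INR m * / (4 * K))) as [hle|hgt]; [now apply IH|].
      set (t0 := INR m * / (4 * K)) in *.
      assert (0 <= t0) by (apply Rmult_le_pos; [apply pos_INR|lra]).
      assert (hz : Rabs (D n t) <= 0).
      { apply le_zero_of_geometric with (A := M * INR (fact n) * (2 * K) ^ n).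
        intros N.
        eapply Rle_trans.
        - apply (taylor_remainder_le D t0 t (M * INR (fact (n + N)) * K ^ (n + N)) N).
          + intros; apply hd; lra.
          + intros k; apply IH; [lra|unfold t0; lra].
          + intros; apply hb; lra.
          + lra.
        - assert (hf := fact_add_le 1 n N ltac:(lra)).
          rewrite pow1, Rmult_1_r in hf. replace (1 + 1) with 2 in hf by ring.
          assert (hp : (t - t0) ^ N <= (/ (4 * K)) ^ N).
          { apply pow_incr. unfold t0 in *. lra. }
          assert (hp0 : 0 <= (t - t0) ^ N) by (apply pow_le; lra).
          assert (hfN := INR_fact_pos N). assert (hfn := INR_fact_pos n).
          assert (hKn : 0 <= K ^ (n + N)) by (apply pow_le; lra).
          apply Rle_trans with
            (M * (INR (fact n) * INR (fact N) * 2 ^ (n + N)) * K ^ (n + N)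
             * (/ (4 * K)) ^ N / INR (fact N)).
          + apply Rmult_le_compat_r; [apply Rlt_le, Rinv_0_lt_compat, hfN|].
            apply Rmult_le_compat; try easy.
            * repeat apply Rmult_le_pos; try easy. apply pos_INR.
            * apply Rmult_le_compat_r; [easy|]. now apply Rmult_le_compat_l.
          + apply Req_le.
            rewrite !pow_add, (Rpow_mult_distr 2 K).
            replace (1 / 2) with (2 * K * (/ (4 * K))) by (field; lra).
            rewrite !Rpow_mult_distr. field. lra. }
      assert (hz' := Rabs_pos (D n t)).
      destruct (Req_dec (D n t) 0) as [e|ne]; [easy|].
      apply Rabs_pos_lt in ne. lra. }
  intros n t ht.
  destruct (archimed (t * (4 * K))) as [hu _].
  apply (main (Z.to_nat (up (t * (4 * K))))); [easy|].
  assert (0 <= t * (4 * K)) by (apply Rmult_le_pos; lra).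
  rewrite INR_IZR_INZ, Z2Nat.id by (apply le_IZR; lra).
  apply Rmult_le_reg_r with (4 * K); [lra|].
  rewrite Rmult_assoc, Rinv_l by lra. lra.
Qed.

Lemma ex_series_scal_geom (c q : R) : 0 <= q < 1 -> ex_series (fun k => c * q ^ k).
Proof.
  intros hq. apply (ex_series_scal (V := R_NormedModule) c (fun k => q ^ k)).
  apply ex_series_geom. rewrite Rabs_pos_eq; lra.
Qed.

Lemma Series_abs_le (a b : nat -> R) :
  (forall n, Rabs (a n) <= b n) -> ex_series b -> Rabs (Series a) <= Series b.
Proof.
  intros h hb. eapply Rle_trans.
  - apply Series_Rabs. apply @ex_series_le with (b := b); [|exact hb].
    intros n. unfold norm; simpl; unfold abs; simpl. rewrite Rabs_Rabsolu. apply h.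
  - apply Series_le; [|exact hb]. intros n; split; [apply Rabs_pos|apply h].
Qed.

(** The coefficient [Nat.iter n PS_derive a k] is a (k+n) (k+n)!/k!; the factor k! on the left
    avoids the quotient. *)
Lemma iter_PS_derive_le (a : nat -> R) (A : R) :
  (forall n, Rabs (a n) <= A) ->
  forall n k, INR (fact k) * Rabs (Nat.iter n PS_derive a k) <= A * INR (fact (k + n)).
Proof.
  intros ha. induction n as [|n IH]; intros k.
  - rewrite Nat.add_0_r. rewrite Rmult_comm.
    apply Rmult_le_compat_r; [apply Rlt_le, INR_fact_pos|apply ha].
  - simpl Nat.iter. unfold PS_derive at 1.
    rewrite Rabs_mult, (Rabs_pos_eq (INR (S k))) by apply pos_INR.
    assert (h := IH (S k)). rewrite INR_fact_S in h.
    replace (k + S n)%nat with (S k + n)%nat by lia. lra.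
Qed.

Lemma CV_radius_iter_derive (a : nat -> R) (n : nat) :
  CV_radius (Nat.iter n PS_derive a) = CV_radius a.
Proof.
  induction n as [|n IH]; [easy|]. simpl. now rewrite CV_radius_derive.
Qed.

Lemma ex_series_bounded (a : nat -> R) : ex_series a -> exists A, forall n, Rabs (a n) <= A.
Proof.
  intros h. apply ex_series_lim_0 in h.
  destruct (filterlim_bounded (V := R_NormedModule) a) as [A hA].
  { exists 0. exact h. }
  exists A. exact hA.
Qed.

Lemma CV_radius_ge_1 (a : nat -> R) (A : R) :
  (forall n, Rabs (a n) <= A) -> Rbar_le 1 (CV_radius a).
Proof.
  intros h. apply CV_radius_bounded. exists A. intros n. now rewrite pow1, Rmult_1_r.
Qed.

(** The differentiated series is dominated term by term by A n! K^n q^k, a geometric series in k. *)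
Lemma PSeries_derive_bound (a : nat -> R) (A r : R) :
  (forall n, Rabs (a n) <= A) -> 0 < r < 1 ->
  exists M K, 0 <= M /\ 0 < K /\
    forall n t, 0 <= t <= r ->
      Rabs (PSeries (Nat.iter n PS_derive a) t) <= M * INR (fact n) * K ^ n.
Proof.
  intros ha hr.
  assert (hA : 0 <= A) by (eapply Rle_trans; [apply Rabs_pos|apply (ha 0%nat)]).
  (* [fact_add_le] is used with [e = 1 - r], not with [e = 1]: the ratio is then q = 1 - (1 - r)^2 <
     1 for every r < 1, where [e = 1] would give 2r. *)
  set (q := (2 - r) * r). set (K := (2 - r) / (1 - r)).
  assert (hq : 0 < q < 1) by (unfold q; nra).
  assert (hK : 0 < K) by (apply Rdiv_lt_0_compat; lra).
  exists (A * / (1 - q)), K. split; [|split; [easy|]].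
  { apply Rmult_le_pos; [easy|]. apply Rlt_le, Rinv_0_lt_compat; lra. }
  intros n t ht.
  assert (hterm : forall k, Rabs (Nat.iter n PS_derive a k * t ^ k)
                            <= A * INR (fact n) * K ^ n * q ^ k).
  { intros k.
    assert (h1 := iter_PS_derive_le a A ha n k).
    assert (h2 := fact_add_le (1 - r) n k ltac:(lra)).
    replace (1 + (1 - r)) with (2 - r) in h2 by ring.
    assert (hk := INR_fact_pos k). assert (hn := INR_fact_pos n).
    rewrite Rabs_mult, <- RPow_abs, (Rabs_pos_eq t) by easy.
    assert (htk : t ^ k <= r ^ k) by (apply pow_incr; lra).
    assert (h0 : 0 < (1 - r) ^ n) by (apply pow_lt; lra).
    set (c := Rabs (Nat.iter n PS_derive a k)) in *.
    assert (hc0 : 0 <= c) by apply Rabs_pos.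
    assert (hc : c <= A * INR (fact n) * K ^ n * (2 - r) ^ k).
    { apply Rmult_le_reg_l with (INR (fact k) * (1 - r) ^ n); [now apply Rmult_lt_0_compat|].
      apply Rle_trans with (A * (INR (fact (n + k)) * (1 - r) ^ n)).
      - rewrite (Nat.add_comm n k). nra.
      - eapply Rle_trans; [apply Rmult_le_compat_l; [easy|exact h2]|].
        apply Req_le. unfold K. rewrite pow_add. unfold Rdiv.
        rewrite Rpow_mult_distr, pow_inv. field. lra. }
    unfold q. rewrite Rpow_mult_distr, <- Rmult_assoc.
    apply Rmult_le_compat; try easy. apply pow_le; lra. }
  eapply Rle_trans.
  - apply Series_abs_le with (b := fun k => A * INR (fact n) * K ^ n * q ^ k); [exact hterm|].
    apply ex_series_scal_geom. lra.
  - rewrite Series_scal_l, Series_geom by (rewrite Rabs_pos_eq; lra).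
    apply Req_le. field. lra.
Qed.

Lemma PSeries_left_continuous_at_1 (a : nat -> R) : ex_series a ->
  filterlim (PSeries a) (at_left 1) (locally (Series a)).
Proof.
  intros ha.
  assert (e : Series a = PSeries a 1).
  { apply Series_ext; intros n. now rewrite pow1, Rmult_1_r. }
  rewrite e.
  destruct (ex_series_bounded a ha) as [A hA].
  assert (h1 := CV_radius_ge_1 a A hA).
  (* Abel's theorem speaks of the radius of convergence itself. If that exceeds 1, the sum is
     differentiable at 1. *)
  destruct (Rbar_le_lt_or_eq_dec 1 (CV_radius a) h1) as [hlt|heq].
  - eapply filterlim_filter_le_1; [apply filter_le_within|].
    apply (@ex_derive_continuous R_AbsRing R_NormedModule).
    eexists. apply is_derive_PSeries. rewrite Rabs_R1. exact hlt.
  - assert (h := Abel a). rewrite <- heq in h. apply h; simpl; try easy; try lra.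
    apply ex_series_ext with a; [|easy]. intros n.
    rewrite pow_n_pow, pow1. unfold scal; simpl; unfold mult; simpl. ring.
Qed.

(* On [0, 1) the sum agrees with [G 0], since otherwise the difference would be
   flat somewhere without vanishing nearby; at 1 this is Abel's theorem. *)
Lemma taylor_series_sum (G : nat -> R -> R) (M K : R) : 0 <= M -> 0 < K ->
  (forall n t, 0 <= t <= 1 -> is_derive (G n) t (G (S n) t)) ->
  (forall n t, 0 <= t <= 1 -> Rabs (G n t) <= M * INR (fact n) * K ^ n) ->
  ex_series (fun n => G n 0 / INR (fact n)) ->
  Series (fun n => G n 0 / INR (fact n)) = G 0%nat 1.
Proof.
  intros hM hK hd hb hex.
  set (a := fun n => G n 0 / INR (fact n)) in *.
  destruct (ex_series_bounded a hex) as [A hA].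
  assert (hrad := CV_radius_ge_1 a A hA).
  set (P := fun n => PSeries (Nat.iter n PS_derive a)).
  assert (hP : forall n t, 0 <= t < 1 -> is_derive (P n) t (P (S n) t)).
  { intros n t ht. apply is_derive_PSeries. rewrite CV_radius_iter_derive.
    rewrite Rabs_pos_eq by lra.
    eapply Rbar_lt_le_trans; [|exact hrad]. simpl; lra. }
  assert (hcoef : forall n k, INR (fact k) * Nat.iter n PS_derive a k = G (k + n)%nat 0).
  { induction n as [|n IH]; intros k.
    - rewrite Nat.add_0_r. simpl. unfold a. field. assert (h := INR_fact_pos k); lra.
    - simpl Nat.iter. unfold PS_derive at 1.
      replace (k + S n)%nat with (S k + n)%nat by lia.
      rewrite <- IH, INR_fact_S. ring. }
  assert (hP0 : forall n, P n 0 = G n 0).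
  { intros n. unfold P. rewrite PSeries_0. change (G n 0) with (G (0 + n)%nat 0).
    rewrite <- hcoef. simpl. ring. }
  assert (heq : forall t, 0 <= t < 1 -> P 0%nat t = G 0%nat t).
  { intros t ht.
    (* The estimates for the power series degenerate at 1, so the comparison takes place on [0, r]
       with t < r < 1 and with constants that depend on t. *)
    set (r := (1 + t) / 2).
    assert (hr : 0 < r < 1) by (unfold r; lra).
    destruct (PSeries_derive_bound a A r hA hr) as [M' [K' [hM' [hK' hb']]]].
    assert (hz := flat_cauchy_zero (fun n u => P n u - G n u) r (M' + M) (K' + K)
      ltac:(lra) ltac:(lra)).
    apply Rminus_diag_uniq.
    apply (hz) with (n := 0%nat).
    - intros n u hu. apply @is_derive_minus; [apply hP; lra|apply hd; lra].
    - intros n. rewrite hP0. ring.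
    - intros n u hu.
      assert (h1 := hb' n u hu). assert (h2 := hb n u ltac:(lra)).
      fold (P n u) in h1 |- *.
      eapply Rle_trans; [apply Rabs_triang|]. rewrite Rabs_Ropp.
      assert (e1 : K' ^ n <= (K' + K) ^ n) by (apply pow_incr; lra).
      assert (e2 : K ^ n <= (K' + K) ^ n) by (apply pow_incr; lra).
      assert (hf := INR_fact_pos n).
      assert (M' * INR (fact n) * K' ^ n <= M' * INR (fact n) * (K' + K) ^ n).
      { apply Rmult_le_compat_l; [nra|easy]. }
      assert (M * INR (fact n) * K ^ n <= M * INR (fact n) * (K' + K) ^ n).
      { apply Rmult_le_compat_l; [nra|easy]. }
      lra.
    - unfold r; lra. }
  apply (@filterlim_locally_unique R R_AbsRing R_NormedModule (at_left 1) _ (PSeries a)).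
  - now apply PSeries_left_continuous_at_1.
  - apply filterlim_ext_loc with (G 0%nat).
    + exists (mkposreal 1 Rlt_0_1). intros t ht hlt.
      symmetry. apply heq.
      unfold ball in ht; simpl in ht; unfold AbsRing_ball, abs, minus, plus, opp in ht; simpl in ht.
      apply Rabs_lt_between in ht. lra.
    + eapply filterlim_filter_le_1; [apply filter_le_within|].
      apply (@ex_derive_continuous R_AbsRing R_NormedModule).
      eexists. apply hd. lra.
Qed.

(** * Functions with Cauchy estimates *)

Definition box (x y d u v : R) : Prop := Rabs (u - x) < d /\ Rabs (v - y) < d.

(** [G i j] is a candidate for the partial derivative of order (i, j) of [G 0 0]. Since the family
    is arbitrary, each construction can present its derivatives by its own formulas;
    [smooth_pderiv_eq] then identifies them with [pderiv]. *)
Definition smooth_at (G : nat -> nat -> R -> R -> R) (x y : R) : Prop :=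
  forall i j, is_derive (fun u => G i j u y) x (G (S i) j x y) /\
              is_derive (fun v => G i j x v) y (G i (S j) x y).

(** As (i+j)! <= 2^(i+j) i! j!, this is the classical estimate with i! j! up to a factor in [rho];
    depending on i + j only, it makes a derivative in x cost as much as one in y. *)
Definition cauchy_at (G : nat -> nat -> R -> R -> R) (M rho x y : R) : Prop :=
  forall i j, Rabs (G i j x y) <= M * INR (fact (i + j)) * rho ^ (i + j).

Definition pderiv (g : R -> R -> R) (i j : nat) (x y : R) : R :=
  Derive_n (fun u => Derive_n (fun v => g u v) j y) i x.

(* Analyticity in the form that is stable under all the operations needed here:
   Cauchy estimates for the partial derivatives, uniform near the point. *)
Definition regular (g : R -> R -> R) (x y : R) : Prop :=
  exists (d : posreal) (M rho : R), 0 <= M /\ 0 <= rho /\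
    forall u v, box x y d u v ->
      smooth_at (pderiv g) u v /\ cauchy_at (pderiv g) M rho u v.

Lemma box_shrink (x y d u v e p q : R) : box x y d u v -> box u v e p q -> box x y (d + e) p q.
Proof.
  intros [h1 h2] [h3 h4]; split.
  - replace (p - x) with ((p - u) + (u - x)) by ring.
    eapply Rle_lt_trans; [apply Rabs_triang|lra].
  - replace (q - y) with ((q - v) + (v - y)) by ring.
    eapply Rle_lt_trans; [apply Rabs_triang|lra].
Qed.

Lemma box_le (x y d e u v : R) : d <= e -> box x y d u v -> box x y e u v.
Proof. intros h [h1 h2]; split; lra. Qed.

Lemma box_center (x y d : R) : 0 < d -> box x y d x y.
Proof. intros h; split; rewrite Rminus_diag, Rabs_R0; easy. Qed.

Lemma box_open (x y d u v : R) : box x y d u v ->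
  exists e : posreal, forall p q, box u v e p q -> box x y d p q.
Proof.
  intros [h1 h2].
  assert (he : 0 < Rmin (d - Rabs (u - x)) (d - Rabs (v - y))) by (apply Rmin_pos; lra).
  exists (mkposreal _ he). intros p q [h3 h4]; simpl in *.
  assert (a1 := Rmin_l (d - Rabs (u - x)) (d - Rabs (v - y))).
  assert (a2 := Rmin_r (d - Rabs (u - x)) (d - Rabs (v - y))).
  split.
  - replace (p - x) with ((p - u) + (u - x)) by ring.
    eapply Rle_lt_trans; [apply Rabs_triang|lra].
  - replace (q - y) with ((q - v) + (v - y)) by ring.
    eapply Rle_lt_trans; [apply Rabs_triang|lra].
Qed.

Lemma ball_Rabs (x e y : R) : ball x e y -> Rabs (y - x) < e.
Proof. easy. Qed.

Lemma Rabs_ball (x e y : R) : Rabs (y - x) < e -> ball x e y.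
Proof. easy. Qed.

Lemma box_locally_x (x y d u v : R) (P : R -> Prop) : box x y d u v ->
  (forall p, box x y d p v -> P p) -> locally u P.
Proof.
  intros hb h. destruct (box_open _ _ _ _ _ hb) as [e he].
  exists e. intros p hp. apply h, he. split; [exact hp|].
  rewrite Rminus_diag, Rabs_R0. apply cond_pos.
Qed.

Lemma box_locally_y (x y d u v : R) (P : R -> Prop) : box x y d u v ->
  (forall q, box x y d u q -> P q) -> locally v P.
Proof.
  intros hb h. destruct (box_open _ _ _ _ _ hb) as [e he].
  exists e. intros q hq. apply h, he. split; [|exact hq].
  rewrite Rminus_diag, Rabs_R0. apply cond_pos.
Qed.

(** Induction on j and then on i. Equality on an open box, not only at the point, is what lets each
    further derivative be taken. *)
Lemma smooth_pderiv_eq (G : nat -> nat -> R -> R -> R) (g : R -> R -> R) (x y d : R) :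
  (forall u v, box x y d u v -> g u v = G 0%nat 0%nat u v) ->
  (forall u v, box x y d u v -> smooth_at G u v) ->
  forall i j u v, box x y d u v -> pderiv g i j u v = G i j u v.
Proof.
  intros h0 hs.
  assert (hj : forall j u v, box x y d u v -> Derive_n (fun w => g u w) j v = G 0%nat j u v).
  { induction j as [|j IH]; intros u v hb.
    - now apply h0.
    - simpl. rewrite (Derive_ext_loc _ (fun w => G 0%nat j u w)).
      + apply is_derive_unique. apply (hs u v hb).
      + apply (box_locally_y x y d u v _ hb); auto. }
  unfold pderiv. induction i as [|i IH]; intros j u v hb.
  - exact (hj j u v hb).
  - simpl. rewrite (Derive_ext_loc _ (fun w => G i j w v)).
    + apply is_derive_unique. apply (hs u v hb).
    + apply (box_locally_x x y d u v _ hb); auto.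
Qed.

Lemma smooth_at_ext (G H : nat -> nat -> R -> R -> R) (x y d : R) :
  (forall i j u v, box x y d u v -> G i j u v = H i j u v) ->
  forall u v, box x y d u v -> smooth_at G u v -> smooth_at H u v.
Proof.
  intros he u v hb hs i j. destruct (hs i j) as [h1 h2].
  rewrite <- !he by easy. split.
  - apply is_derive_ext_loc with (fun w => G i j w v); [|easy].
    apply (box_locally_x x y d u v _ hb); auto.
  - apply is_derive_ext_loc with (fun w => G i j u w); [|easy].
    apply (box_locally_y x y d u v _ hb); auto.
Qed.

(** The introduction rule for [regular]: any explicit family of derivatives with the estimates will
    do. *)
Lemma regular_of_family (G : nat -> nat -> R -> R -> R) (g : R -> R -> R)
    (x y : R) (d : posreal) (M rho : R) : 0 <= M -> 0 <= rho ->
  (forall u v, box x y d u v -> g u v = G 0%nat 0%nat u v) ->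
  (forall u v, box x y d u v -> smooth_at G u v /\ cauchy_at G M rho u v) ->
  regular g x y.
Proof.
  intros hM hr h0 hs. exists d, M, rho. split; [easy|split; [easy|]].
  assert (he := smooth_pderiv_eq G g x y d h0 (fun u v hb => proj1 (hs u v hb))).
  intros u v hb. split.
  - apply (smooth_at_ext G _ x y d); try easy.
    + intros; symmetry; now apply he.
    + now apply hs.
  - intros i j. rewrite he by easy. now apply hs.
Qed.

Lemma regular_ext (f g : R -> R -> R) (x y : R) (d : posreal) :
  (forall u v, box x y d u v -> f u v = g u v) -> regular f x y -> regular g x y.
Proof.
  intros he [e [M [rho [hM [hr h]]]]].
  assert (hp : 0 < Rmin d e) by (apply Rmin_pos; apply cond_pos).
  apply regular_of_family with (G := pderiv f) (d := mkposreal _ hp) (M := M) (rho := rho);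
    try easy; simpl.
  - intros u v hb. symmetry. apply he. eapply box_le; [apply Rmin_l|exact hb].
  - intros u v hb. apply h. eapply box_le; [apply Rmin_r|exact hb].
Qed.

Lemma cauchy_at_le (G : nat -> nat -> R -> R -> R) (M rho M' rho' x y : R) :
  0 <= M -> 0 <= rho -> M <= M' -> rho <= rho' ->
  cauchy_at G M rho x y -> cauchy_at G M' rho' x y.
Proof.
  intros h1 h2 h3 h4 h i j. eapply Rle_trans; [apply h|].
  assert (hf := INR_fact_pos (i + j)).
  apply Rmult_le_compat; [nra|now apply pow_le|nra|apply pow_incr; lra].
Qed.

(** Compactness of [0, 1], used later for segments and for arcs of rotation. *)
Lemma regular_uniform (g : R -> R -> R) (c1 c2 : R -> R) :
  (forall t, continuous c1 t) -> (forall t, continuous c2 t) ->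
  (forall t, 0 <= t <= 1 -> regular g (c1 t) (c2 t)) ->
  exists (d : posreal) (M rho : R), 0 <= M /\ 0 <= rho /\
    forall t u v, 0 <= t <= 1 -> box (c1 t) (c2 t) d u v ->
      smooth_at (pderiv g) u v /\ cauchy_at (pderiv g) M rho u v.
Proof.
  intros hc1 hc2 hr.
  (* A single number [e] serves as radius of the neighbourhoods, and its inverse as both constants,
     so that one positive lower bound for [e] makes everything uniform. *)
  set (Q := fun (t : R) (e : posreal) => forall s u v, Rabs (s - t) < e ->
    box (c1 s) (c2 s) e u v ->
    smooth_at (pderiv g) u v /\ cauchy_at (pderiv g) (/ e) (/ e) u v).
  assert (hQ : forall t, exists e : posreal, 0 <= t <= 1 -> Q t e).
  { intros t. destruct (classic (0 <= t <= 1)) as [ht|ht].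
    2: { exists (mkposreal 1 Rlt_0_1). easy. }
    destruct (hr t ht) as [d [M [rho [hM [hrho h]]]]].
    assert (hd2 : 0 < d / 2) by (apply is_pos_div_2).
    destruct (hc1 t (ball (c1 t) (d / 2))) as [e1 he1].
    { exists (mkposreal _ hd2). easy. }
    destruct (hc2 t (ball (c2 t) (d / 2))) as [e2 he2].
    { exists (mkposreal _ hd2). easy. }
    assert (hm : 0 < / (M + rho + 1)) by (apply Rinv_0_lt_compat; lra).
    assert (hp : 0 < Rmin (Rmin e1 e2) (Rmin (d / 2) (/ (M + rho + 1)))).
    { repeat apply Rmin_pos; try apply cond_pos; easy. }
    set (e := mkposreal _ hp).
    assert (l1 : e <= e1) by (simpl; eapply Rle_trans; apply Rmin_l).
    assert (l2 : e <= e2) by (simpl; eapply Rle_trans; [apply Rmin_l|apply Rmin_r]).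
    assert (l3 : e <= d / 2) by (simpl; eapply Rle_trans; [apply Rmin_r|apply Rmin_l]).
    assert (l4 : e <= / (M + rho + 1)) by (simpl; eapply Rle_trans; apply Rmin_r).
    assert (l5 : M + rho + 1 <= / e).
    { rewrite <- (Rinv_inv (M + rho + 1)). apply Rinv_le_contravar; [apply cond_pos|easy]. }
    exists e. intros _ s u v hs hb.
    destruct (h u v) as [h1 h2].
    { replace (pos d) with (d / 2 + d / 2) by field.
      apply box_shrink with (c1 s) (c2 s).
      - split.
        + apply he1. apply Rabs_ball. lra.
        + apply he2. apply Rabs_ball. lra.
      - now apply box_le with e. }
    split; [easy|]. apply cauchy_at_le with M rho; try easy; lra. }
  set (delta := fun t => proj1_sig (constructive_indefinite_description _ (hQ t))).
  assert (hdelta : forall t, 0 <= t <= 1 -> Q t (delta t)).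
  { intros t. exact (proj2_sig (constructive_indefinite_description _ (hQ t))). }
  (* This gives a [d] such that each t is within [delta s] of some s with [d <= delta s], but only
     up to double negation; hence the classical step below. *)
  destruct (compactness_value_1d 0 1 delta) as [d hd].
  assert (hi : 0 < / d) by (apply Rinv_0_lt_compat, cond_pos).
  exists d, (/ d), (/ d). split; [lra|split; [lra|]].
  intros t u v ht hb.
  apply NNPP; intros hn. apply (hd t ht). intros [s [hs [h1 h2]]]. apply hn.
  destruct (hdelta s hs t u v h1) as [k1 k2].
  { now apply box_le with d. }
  split; [easy|].
  assert (hi' : 0 < / delta s) by (apply Rinv_0_lt_compat, cond_pos).
  assert (hle : / delta s <= / d) by (apply Rinv_le_contravar; [apply cond_pos|easy]).
  apply cauchy_at_le with (/ delta s) (/ delta s); try easy; lra.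
Qed.

(** * The operator L on families of partial derivatives *)

(* The partial derivatives of [L_op g], by Leibniz; at [i = 0] or [j = 0] the
   junk value [pred 0 = 0] is multiplied by [INR 0]. *)
Definition L_family (G : nat -> nat -> R -> R -> R) (i j : nat) (x y : R) : R :=
  y * G (S i) j x y + INR j * G (S i) (pred j) x y
  - (x * G i (S j) x y + INR i * G (pred i) (S j) x y).

Lemma smooth_L_family (G : nat -> nat -> R -> R -> R) (x y : R) :
  smooth_at G x y -> smooth_at (L_family G) x y.
Proof.
  intros h i j. unfold L_family. split.
  - eapply (is_derive_ext (fun u => y * G (S i) j u y + INR j * G (S i) (pred j) u y
      - (u * G i (S j) u y + INR i * G (pred i) (S j) u y))); [easy|].
    evar_last.
    + apply @is_derive_minus; apply @is_derive_plus.
      * apply is_derive_scal, (h (S i) j).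
      * apply is_derive_scal, (h (S i) (pred j)).
      * apply @is_derive_mult; [apply @is_derive_id|apply (h i (S j))|intros; apply Rmult_comm].
      * apply is_derive_scal, (h (pred i) (S j)).
    + rewrite S_INR. unfold minus, plus, opp, mult, one; cbn -[INR].
      destruct i as [|i]; cbn -[INR]; [change (INR 0) with 0|]; ring.
  - eapply (is_derive_ext (fun u => u * G (S i) j x u + INR j * G (S i) (pred j) x u
      - (x * G i (S j) x u + INR i * G (pred i) (S j) x u))); [easy|].
    evar_last.
    + apply @is_derive_minus; apply @is_derive_plus.
      * apply @is_derive_mult; [apply @is_derive_id|apply (h (S i) j)|intros; apply Rmult_comm].
      * apply is_derive_scal, (h (S i) (pred j)).
      * apply is_derive_scal, (h i (S j)).
      * apply is_derive_scal, (h (pred i) (S j)).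
    + rewrite S_INR. unfold minus, plus, opp, mult, one; cbn -[INR].
      destruct j as [|j]; cbn -[INR]; [change (INR 0) with 0|]; ring.
Qed.

Lemma smooth_iter_L (G : nat -> nat -> R -> R -> R) (n : nat) (x y : R) :
  smooth_at G x y -> smooth_at (Nat.iter n L_family G) x y.
Proof.
  intros h. induction n as [|n IH]; [easy|]. simpl. now apply smooth_L_family.
Qed.

(** Each application of L costs a factor (2B rho + 1)(i+j+n+1). The two terms with coefficients y
    and x raise the order of differentiation by one and contribute 2B rho (i+j+n+1). The two Leibniz
    terms keep the order i + j and carry the coefficients i and j, whose sum is at most i+j+n+1. *)
Lemma iter_L_bound (G : nat -> nat -> R -> R -> R) (M rho B x y : R) :
  0 <= M -> 0 <= rho -> Rabs x <= B -> Rabs y <= B -> cauchy_at G M rho x y ->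
  forall n i j, Rabs (Nat.iter n L_family G i j x y)
    <= M * (2 * B * rho + 1) ^ n * INR (fact (i + j + n)) * rho ^ (i + j).
Proof.
  intros hM hr hx hy hG.
  assert (hB : 0 <= B) by (eapply Rle_trans; [apply Rabs_pos|exact hx]).
  induction n as [|n IH]; intros i j.
  - rewrite Nat.add_0_r. simpl (_ ^ 0). rewrite Rmult_1_r. apply hG.
  - set (K := 2 * B * rho + 1) in *. set (H := Nat.iter n L_family G) in *.
    assert (hK : 0 <= K) by (unfold K; assert (0 <= B * rho) by (now apply Rmult_le_pos); lra).
    set (c := M * K ^ n * INR (fact (i + j + n)) * rho ^ (i + j)).
    assert (hf := INR_fact_pos (i + j + n)).
    assert (hc : 0 <= c).
    { unfold c. repeat apply Rmult_le_pos; try apply pow_le; lra. }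
    assert (b1 : Rabs (H (S i) j x y) <= c * (INR (S (i + j + n)) * rho)).
    { eapply Rle_trans; [apply IH|]. apply Req_le.
      replace (S i + j)%nat with (S (i + j)) by lia.
      change (S (i + j) + n)%nat with (S (i + j + n)). rewrite INR_fact_S.
      unfold c. simpl pow. ring. }
    assert (b2 : Rabs (H i (S j) x y) <= c * (INR (S (i + j + n)) * rho)).
    { eapply Rle_trans; [apply IH|]. apply Req_le.
      replace (i + S j)%nat with (S (i + j)) by lia.
      change (S (i + j) + n)%nat with (S (i + j + n)). rewrite INR_fact_S.
      unfold c. simpl pow. ring. }
    assert (b3 : Rabs (INR j * H (S i) (pred j) x y) <= INR j * c).
    { rewrite Rabs_mult, (Rabs_pos_eq (INR j)) by apply pos_INR.
      destruct j as [|j]; [simpl; lra|]. apply Rmult_le_compat_l; [apply pos_INR|].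
      eapply Rle_trans; [apply IH|]. apply Req_le. simpl pred.
      replace (S i + j)%nat with (i + S j)%nat by lia. unfold c; ring. }
    assert (b4 : Rabs (INR i * H (pred i) (S j) x y) <= INR i * c).
    { rewrite Rabs_mult, (Rabs_pos_eq (INR i)) by apply pos_INR.
      destruct i as [|i]; [simpl; lra|]. apply Rmult_le_compat_l; [apply pos_INR|].
      eapply Rle_trans; [apply IH|]. apply Req_le. simpl pred.
      replace (i + S j)%nat with (S i + j)%nat by lia. unfold c; ring. }
    assert (hN : 0 <= INR (S (i + j + n))) by apply pos_INR.
    assert (c1 : Rabs (y * H (S i) j x y) <= B * (c * (INR (S (i + j + n)) * rho))).
    { rewrite Rabs_mult. apply Rmult_le_compat; auto using Rabs_pos. }
    assert (c2 : Rabs (x * H i (S j) x y) <= B * (c * (INR (S (i + j + n)) * rho))).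
    { rewrite Rabs_mult. apply Rmult_le_compat; auto using Rabs_pos. }
    change (Nat.iter (S n) L_family G i j x y) with (L_family H i j x y). unfold L_family.
    eapply Rle_trans; [apply Rabs_triang|]. rewrite Rabs_Ropp.
    assert (t1 := Rabs_triang (y * H (S i) j x y) (INR j * H (S i) (pred j) x y)).
    assert (t2 := Rabs_triang (x * H i (S j) x y) (INR i * H (pred i) (S j) x y)).
    assert (hij : INR i + INR j <= INR (S (i + j + n))).
    { rewrite <- plus_INR. apply le_INR; lia. }
    apply Rle_trans with (2 * B * (c * (INR (S (i + j + n)) * rho)) + (INR i + INR j) * c);
      [lra|].
    apply Rle_trans with (2 * B * (c * (INR (S (i + j + n)) * rho)) + INR (S (i + j + n)) * c).
    { apply Rplus_le_compat_l. now apply Rmult_le_compat_r. }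
    apply Req_le. replace (i + j + S n)%nat with (S (i + j + n)) by lia.
    rewrite INR_fact_S. unfold c. fold K. simpl pow.
    transitivity (K * (INR (S (i + j + n)) * (M * K ^ n * INR (fact (i + j + n)) * rho ^ (i + j))));
      [unfold K; ring|ring].
Qed.

Lemma L_op_family (G : nat -> nat -> R -> R -> R) (g : R -> R -> R) (x y d : R) :
  (forall u v, box x y d u v -> g u v = G 0%nat 0%nat u v) ->
  (forall u v, box x y d u v -> smooth_at G u v) ->
  forall u v, box x y d u v -> L_op g u v = L_family G 0%nat 0%nat u v.
Proof.
  intros he hs u v hb. unfold L_op, L_family. simpl INR. simpl pred.
  destruct (hs u v hb 0%nat 0%nat) as [h1 h2].
  assert (e1 : Derive (fun w => g w v) u = G 1%nat 0%nat u v).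
  { apply is_derive_unique. apply is_derive_ext_loc with (2 := h1).
    apply (box_locally_x x y d u v _ hb). intros; symmetry; auto. }
  assert (e2 : Derive (fun w => g u w) v = G 0%nat 1%nat u v).
  { apply is_derive_unique. apply is_derive_ext_loc with (2 := h2).
    apply (box_locally_y x y d u v _ hb). intros; symmetry; auto. }
  rewrite e1, e2. ring.
Qed.

Lemma iter_L_op_family (g : R -> R -> R) (x y d : R) :
  (forall u v, box x y d u v -> smooth_at (pderiv g) u v) ->
  forall n u v, box x y d u v ->
    Nat.iter n L_op g u v = Nat.iter n L_family (pderiv g) 0%nat 0%nat u v.
Proof.
  intros hs. induction n as [|n IH]; intros u v hb; [easy|].
  simpl. apply (L_op_family (Nat.iter n L_family (pderiv g)) _ x y d); auto.
  intros; apply smooth_iter_L; auto.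
Qed.

Lemma iter_L_op_bound (g : R -> R -> R) (M rho B x y : R) (d : posreal) :
  0 <= M -> 0 <= rho -> Rabs x <= B -> Rabs y <= B ->
  (forall u v, box x y d u v -> smooth_at (pderiv g) u v) ->
  cauchy_at (pderiv g) M rho x y ->
  forall n, Rabs (Nat.iter n L_op g x y) <= M * INR (fact n) * (2 * B * rho + 1) ^ n.
Proof.
  intros hM hr hx hy hs hc n.
  rewrite (iter_L_op_family g x y d hs n x y) by (apply box_center, cond_pos).
  eapply Rle_trans; [apply (iter_L_bound _ M rho B); auto|].
  apply Req_le. simpl. ring.
Qed.

(** * Continuity and total differentiability from bounds on partial derivatives *)

Lemma abs_sub_le_of_derive (h dh : R -> R) (C x y d : R) :
  (forall t, Rabs (t - x) < d -> is_derive h t (dh t) /\ Rabs (dh t) <= C) ->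
  Rabs (y - x) < d -> Rabs (h y - h x) <= C * Rabs (y - x).
Proof.
  intros hd hy. apply bounded_variation with dh. intros t ht. apply hd. lra.
Qed.

(** [smooth_at] speaks of one variable at a time. Joint continuity comes from the Lipschitz bound
    along the path from (x, y) to (x, v) to (u, v). *)
Lemma smooth_bounded_continuous (G : nat -> nat -> R -> R -> R) (i j : nat) (C x y d : R) :
  0 < d ->
  (forall u v, box x y d u v -> smooth_at G u v) ->
  (forall u v, box x y d u v ->
     Rabs (G (S i) j u v) <= C /\ Rabs (G i (S j) u v) <= C) ->
  continuous (fun z : R * R => G i j (fst z) (snd z)) (x, y).
Proof.
  intros hd hs hb.
  apply (proj1 (continuity_2d_pt_filterlim (G i j) x y)).
  assert (hC : 0 <= C).
  { eapply Rle_trans; [apply Rabs_pos|]. apply (hb x y). now apply box_center. }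
  intros eps.
  assert (he : 0 < Rmin d (eps / (2 * (C + 1)))).
  { apply Rmin_pos; [easy|]. apply Rdiv_lt_0_compat; [apply cond_pos|lra]. }
  exists (mkposreal _ he). simpl. intros u v hu hv.
  assert (l1 := Rmin_l d (eps / (2 * (C + 1)))).
  assert (l2 := Rmin_r d (eps / (2 * (C + 1)))).
  assert (k1 : Rabs (G i j u v - G i j x v) <= C * Rabs (u - x)).
  { apply (abs_sub_le_of_derive (fun w => G i j w v) (fun w => G (S i) j w v) C x u d); [|lra].
    intros t ht. assert (hbt : box x y d t v) by (split; lra). split.
    - now apply hs.
    - now apply hb. }
  assert (k2 : Rabs (G i j x v - G i j x y) <= C * Rabs (v - y)).
  { apply (abs_sub_le_of_derive (fun w => G i j x w) (fun w => G i (S j) x w) C y v d); [|lra].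
    intros t ht. assert (hbt : box x y d x t).
    { split; [rewrite Rminus_diag, Rabs_R0|]; lra. }
    split.
    - now apply hs.
    - now apply hb. }
  replace (G i j u v - G i j x y) with ((G i j u v - G i j x v) + (G i j x v - G i j x y)) by ring.
  eapply Rle_lt_trans; [apply Rabs_triang|].
  assert (m1 : (C + 1) * Rabs (u - x) < eps / 2).
  { replace (eps / 2) with ((C + 1) * (eps / (2 * (C + 1)))) by (field; lra).
    apply Rmult_lt_compat_l; lra. }
  assert (m2 : (C + 1) * Rabs (v - y) < eps / 2).
  { replace (eps / 2) with ((C + 1) * (eps / (2 * (C + 1)))) by (field; lra).
    apply Rmult_lt_compat_l; lra. }
  assert (p1 := Rabs_pos (u - x)). assert (p2 := Rabs_pos (v - y)). lra.
Qed.

(** Both partial derivatives exist nearby and the one in the first variable is continuous at the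
    point; the two bounds are those that make [G (S i) j] continuous. *)
Lemma smooth_differentiable (G : nat -> nat -> R -> R -> R) (i j : nat) (C x y d : R) :
  0 < d ->
  (forall u v, box x y d u v -> smooth_at G u v) ->
  (forall u v, box x y d u v ->
     Rabs (G (S (S i)) j u v) <= C /\ Rabs (G (S i) (S j) u v) <= C) ->
  differentiable_pt_lim (G i j) x y (G (S i) j x y) (G i (S j) x y).
Proof.
  intros hd hs hb.
  apply filterdiff_differentiable_pt_lim.
  apply (is_derive_filterdiff (G i j) x y (G (S i) j) (G i (S j) x y)).
  - exists (mkposreal d hd). intros [u v] [h1 h2]; simpl in *.
    apply (hs u v). now split.
  - apply (hs x y). now apply box_center.
  - now apply smooth_bounded_continuous with C d.
Qed.

(** * Rotations and the exponential of L *)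

Lemma is_derive_rot_x (phi x y t : R) :
  is_derive (fun s => rot_x (s * phi) x y) t (phi * rot_y (t * phi) x y).
Proof. unfold rot_x, rot_y. auto_derive; [easy|]. ring. Qed.

Lemma is_derive_rot_y (phi x y t : R) :
  is_derive (fun s => rot_y (s * phi) x y) t (- phi * rot_x (t * phi) x y).
Proof. unfold rot_x, rot_y. auto_derive; [easy|]. ring. Qed.

Lemma continuous_rot_x (phi x y t : R) : continuous (fun s => rot_x (s * phi) x y) t.
Proof.
  apply (@ex_derive_continuous R_AbsRing R_NormedModule). eexists. apply is_derive_rot_x.
Qed.

Lemma continuous_rot_y (phi x y t : R) : continuous (fun s => rot_y (s * phi) x y) t.
Proof.
  apply (@ex_derive_continuous R_AbsRing R_NormedModule). eexists. apply is_derive_rot_y.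
Qed.

Lemma Rabs_cos_le (t : R) : Rabs (cos t) <= 1.
Proof. apply Rabs_le, COS_bound. Qed.

Lemma Rabs_sin_le (t : R) : Rabs (sin t) <= 1.
Proof. apply Rabs_le, SIN_bound. Qed.

Lemma Rabs_rot_x_le (phi x y : R) : Rabs (rot_x phi x y) <= Rabs x + Rabs y.
Proof.
  unfold rot_x. eapply Rle_trans; [apply Rabs_triang|]. rewrite !Rabs_mult.
  assert (h1 := Rabs_cos_le phi). assert (h2 := Rabs_sin_le phi).
  assert (h3 := Rabs_pos x). assert (h4 := Rabs_pos y).
  assert (Rabs (cos phi) * Rabs x <= 1 * Rabs x) by (apply Rmult_le_compat_r; easy).
  assert (Rabs (sin phi) * Rabs y <= 1 * Rabs y) by (apply Rmult_le_compat_r; easy).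
  lra.
Qed.

Lemma Rabs_rot_y_le (phi x y : R) : Rabs (rot_y phi x y) <= Rabs x + Rabs y.
Proof.
  unfold rot_y. eapply Rle_trans; [apply Rabs_triang|]. rewrite !Rabs_mult, Rabs_Ropp.
  assert (h1 := Rabs_cos_le phi). assert (h2 := Rabs_sin_le phi).
  assert (h3 := Rabs_pos x). assert (h4 := Rabs_pos y).
  assert (Rabs (sin phi) * Rabs x <= 1 * Rabs x) by (apply Rmult_le_compat_r; easy).
  assert (Rabs (cos phi) * Rabs y <= 1 * Rabs y) by (apply Rmult_le_compat_r; easy).
  lra.
Qed.

Lemma rot_x_0 (x y : R) : rot_x 0 x y = x.
Proof. unfold rot_x. rewrite cos_0, sin_0. ring. Qed.

Lemma rot_y_0 (x y : R) : rot_y 0 x y = y.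
Proof. unfold rot_y. rewrite cos_0, sin_0. ring. Qed.

(** The derivative of [rot_x] in the angle is [rot_y], which is bounded by |x| + |y|. *)
Lemma Rabs_rot_x_sub_le (phi x y : R) :
  Rabs (rot_x phi x y - x) <= Rabs phi * (Rabs x + Rabs y).
Proof.
  replace (rot_x phi x y - x) with (rot_x phi x y - rot_x 0 x y) by now rewrite rot_x_0.
  replace (Rabs phi * (Rabs x + Rabs y)) with ((Rabs x + Rabs y) * Rabs (phi - 0))
    by (rewrite Rminus_0_r; ring).
  apply (bounded_variation (fun s => rot_x s x y) (fun s => 1 * rot_y (s * 1) x y)).
  intros t _. split.
  - apply is_derive_ext with (fun s => rot_x (s * 1) x y); [intros; now rewrite Rmult_1_r|].
    apply is_derive_rot_x.
  - rewrite Rmult_1_l. apply Rabs_rot_y_le.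
Qed.

Lemma Rabs_rot_y_sub_le (phi x y : R) :
  Rabs (rot_y phi x y - y) <= Rabs phi * (Rabs x + Rabs y).
Proof.
  replace (rot_y phi x y - y) with (rot_y phi x y - rot_y 0 x y) by now rewrite rot_y_0.
  replace (Rabs phi * (Rabs x + Rabs y)) with ((Rabs x + Rabs y) * Rabs (phi - 0))
    by (rewrite Rminus_0_r; ring).
  apply (bounded_variation (fun s => rot_y s x y) (fun s => - (1) * rot_x (s * 1) x y)).
  intros t _. split.
  - apply is_derive_ext with (fun s => rot_y (s * 1) x y); [intros; now rewrite Rmult_1_r|].
    apply is_derive_rot_y.
  - rewrite Rabs_mult, Rabs_Ropp, Rabs_R1, Rmult_1_l. apply Rabs_rot_x_le.
Qed.

Lemma rot_x_neg_rot (phi x y : R) : rot_x phi (rot_x (- phi) x y) (rot_y (- phi) x y) = x.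
Proof.
  unfold rot_x, rot_y. rewrite cos_neg, sin_neg.
  assert (h := sin2_cos2 phi). unfold Rsqr in h.
  transitivity ((sin phi * sin phi + cos phi * cos phi) * x); [ring|rewrite h; ring].
Qed.

Lemma rot_y_neg_rot (phi x y : R) : rot_y phi (rot_x (- phi) x y) (rot_y (- phi) x y) = y.
Proof.
  unfold rot_x, rot_y. rewrite cos_neg, sin_neg.
  assert (h := sin2_cos2 phi). unfold Rsqr in h.
  transitivity ((sin phi * sin phi + cos phi * cos phi) * y); [ring|rewrite h; ring].
Qed.

Lemma rot_x_add (s t x y : R) : rot_x s (rot_x t x y) (rot_y t x y) = rot_x (s + t) x y.
Proof. unfold rot_x, rot_y. rewrite cos_plus, sin_plus. ring. Qed.

Lemma rot_y_add (s t x y : R) : rot_y s (rot_x t x y) (rot_y t x y) = rot_y (s + t) x y.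
Proof. unfold rot_x, rot_y. rewrite cos_plus, sin_plus. ring. Qed.

(** The rotated point (X, Y) moves with velocity phi (Y, -X), so the chain rule yields phi (Y D_x -
    X D_y), which is phi L. *)
Lemma is_derive_iter_L_rot (g : R -> R -> R) (phi x y t : R) (n : nat) :
  regular g (rot_x (t * phi) x y) (rot_y (t * phi) x y) ->
  is_derive (fun s => Nat.iter n L_op g (rot_x (s * phi) x y) (rot_y (s * phi) x y)) t
    (phi * Nat.iter (S n) L_op g (rot_x (t * phi) x y) (rot_y (t * phi) x y)).
Proof.
  intros [d [M [rho [hM [hr h]]]]].
  set (a := rot_x (t * phi) x y) in *. set (b := rot_y (t * phi) x y) in *.
  assert (hs : forall u v, box a b d u v -> smooth_at (pderiv g) u v) by apply h.
  assert (hL := iter_L_op_family g a b d hs).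
  set (H := Nat.iter n L_family (pderiv g)).
  set (B := Rabs a + Rabs b + d).
  assert (hd := cond_pos d).
  (* A bound for the second derivatives of [H] on the box, whose coordinates [B] bounds. It makes
     [H] totally differentiable, as the chain rule in two variables requires. *)
  set (C := M * (2 * B * rho + 1) ^ n * INR (fact (2 + n)) * rho ^ 2).
  assert (hC : forall i j u v, (i + j = 2)%nat -> box a b d u v -> Rabs (H i j u v) <= C).
  { intros i j u v hij hb.
    assert (hu : Rabs u <= B).
    { replace u with ((u - a) + a) by ring. eapply Rle_trans; [apply Rabs_triang|].
      destruct hb. assert (k := Rabs_pos b). unfold B. lra. }
    assert (hv : Rabs v <= B).
    { replace v with ((v - b) + b) by ring. eapply Rle_trans; [apply Rabs_triang|].
      destruct hb. assert (k := Rabs_pos a). unfold B. lra. }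
    unfold C. rewrite <- hij. apply (iter_L_bound _ M rho B); try easy. now apply h. }
  assert (hdiff : differentiable_pt_lim (H 0%nat 0%nat) a b
    (H 1%nat 0%nat a b) (H 0%nat 1%nat a b)).
  { apply smooth_differentiable with C d; try easy.
    - intros; now apply smooth_iter_L, hs.
    - intros; split; now apply hC. }
  rewrite hL by now apply box_center.
  apply is_derive_ext_loc with
    (fun s => H 0%nat 0%nat (rot_x (s * phi) x y) (rot_y (s * phi) x y)).
  - destruct (continuous_rot_x phi x y t (ball a d)) as [e1 he1]; [exists d; easy|].
    destruct (continuous_rot_y phi x y t (ball b d)) as [e2 he2]; [exists d; easy|].
    assert (he : 0 < Rmin e1 e2) by (apply Rmin_pos; apply cond_pos).
    exists (mkposreal _ he). intros s hs'. symmetry. apply hL. simpl in hs'.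
    split.
    + apply he1. eapply ball_le; [apply Rmin_l|exact hs'].
    + apply he2. eapply ball_le; [apply Rmin_r|exact hs'].
  - apply is_derive_Reals.
    replace (phi * Nat.iter (S n) L_family (pderiv g) 0%nat 0%nat a b)
      with (H 1%nat 0%nat a b * (phi * b) + H 0%nat 1%nat a b * (- phi * a)).
    + apply derivable_pt_lim_comp_2d with (f2 := fun s => rot_x (s * phi) x y)
        (f3 := fun s => rot_y (s * phi) x y).
      * exact hdiff.
      * apply is_derive_Reals, is_derive_rot_x.
      * apply is_derive_Reals, is_derive_rot_y.
    + change (Nat.iter (S n) L_family (pderiv g)) with (L_family H).
      unfold L_family. simpl INR. ring.
Qed.

Lemma exp_L_eq_rot (g : R -> R -> R) (phi x y : R) :
  (forall t, 0 <= t <= 1 -> regular g (rot_x (t * phi) x y) (rot_y (t * phi) x y)) ->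
  ex_exp_L phi g x y -> exp_L phi g x y = g (rot_x phi x y) (rot_y phi x y).
Proof.
  intros hr hex.
  destruct (regular_uniform g _ _ (continuous_rot_x phi x y) (continuous_rot_y phi x y) hr)
    as [d [M [rho [hM [hrho h]]]]].
  (* The factor phi^n rescales the arc to the parameter interval [0, 1], which treats both signs of
     phi at once. *)
  set (G := fun n t => phi ^ n * Nat.iter n L_op g (rot_x (t * phi) x y) (rot_y (t * phi) x y)).
  set (K := 2 * (Rabs x + Rabs y) * rho + 1).
  assert (hB : 0 <= Rabs x + Rabs y).
  { assert (h1 := Rabs_pos x). assert (h2 := Rabs_pos y). lra. }
  assert (hK : 1 <= K).
  { unfold K. assert (0 <= 2 * (Rabs x + Rabs y) * rho) by (apply Rmult_le_pos; lra). lra. }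
  assert (e : forall n, exp_L_term phi g x y n = G n 0 / INR (fact n)).
  { intros n. unfold exp_L_term, G. rewrite Rmult_0_l, rot_x_0, rot_y_0.
    unfold Rdiv. ring. }
  unfold exp_L. rewrite (Series_ext _ _ e).
  assert (hf := Rabs_pos phi).
  (* The summand 1 keeps the constant positive when phi = 0. *)
  rewrite (taylor_series_sum G M ((Rabs phi + 1) * K)); try easy.
  - unfold G. simpl. now rewrite !Rmult_1_l.
  - apply Rmult_lt_0_compat; lra.
  - intros n t ht. unfold G. simpl (phi ^ S n).
    replace (phi * phi ^ n * Nat.iter (S n) L_op g (rot_x (t * phi) x y) (rot_y (t * phi) x y))
      with (phi ^ n * (phi * Nat.iter (S n) L_op g (rot_x (t * phi) x y) (rot_y (t * phi) x y)))
      by ring.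
    apply is_derive_scal. now apply is_derive_iter_L_rot, hr.
  - intros n t ht. unfold G. rewrite Rabs_mult, <- RPow_abs, Rpow_mult_distr.
    assert (hb := iter_L_op_bound g M rho (Rabs x + Rabs y)
      (rot_x (t * phi) x y) (rot_y (t * phi) x y) d hM hrho
      (Rabs_rot_x_le _ _ _) (Rabs_rot_y_le _ _ _)).
    assert (hb' := hb (fun u v hu => proj1 (h t u v ht hu))
      (proj2 (h t _ _ ht (box_center _ _ _ (cond_pos d)))) n). fold K in hb'.
    assert (hp : Rabs phi ^ n <= (Rabs phi + 1) ^ n) by (apply pow_incr; lra).
    replace (M * INR (fact n) * ((Rabs phi + 1) ^ n * K ^ n))
      with ((Rabs phi + 1) ^ n * (M * INR (fact n) * K ^ n)) by ring.
    apply Rmult_le_compat; try easy; [now apply pow_le|apply Rabs_pos].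
  - now apply (ex_series_ext _ _ e).
Qed.

Lemma exp_L_term_bound (g : R -> R -> R) (phi x y M K : R) :
  0 <= M -> 0 <= K ->
  (forall n, Rabs (Nat.iter n L_op g x y) <= M * INR (fact n) * K ^ n) ->
  forall n, Rabs (exp_L_term phi g x y n) <= M * (Rabs phi * K) ^ n.
Proof.
  intros hM hK h n. unfold exp_L_term.
  assert (hf := INR_fact_pos n).
  rewrite Rabs_mult, Rabs_div by lra. rewrite <- RPow_abs, (Rabs_pos_eq (INR (fact n))) by lra.
  rewrite Rpow_mult_distr.
  apply Rle_trans with (Rabs phi ^ n / INR (fact n) * (M * INR (fact n) * K ^ n)).
  - apply Rmult_le_compat_l; [|apply h].
    apply Rmult_le_pos; [apply pow_le, Rabs_pos|apply Rlt_le, Rinv_0_lt_compat, hf].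
  - apply Req_le. field. lra.
Qed.

Lemma ex_exp_L_small (g : R -> R -> R) (phi x y M K : R) :
  0 <= M -> 0 <= K ->
  (forall n, Rabs (Nat.iter n L_op g x y) <= M * INR (fact n) * K ^ n) ->
  Rabs phi * K < 1 -> ex_exp_L phi g x y.
Proof.
  intros hM hK h hphi.
  apply @ex_series_le with (b := fun n => M * (Rabs phi * K) ^ n).
  - exact (exp_L_term_bound g phi x y M K hM hK h).
  - apply ex_series_scal_geom. split; [|easy].
    apply Rmult_le_pos; [apply Rabs_pos|easy].
Qed.

(** The tail from n = 2 on is at most M (|phi| K)^2 times the sum of the powers of 1/2, which is
    2. *)
Lemma exp_L_first_order (g : R -> R -> R) (phi x y M K : R) :
  0 <= M -> 0 <= K ->
  (forall n, Rabs (Nat.iter n L_op g x y) <= M * INR (fact n) * K ^ n) ->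
  Rabs phi * K <= 1 / 2 ->
  Rabs (exp_L phi g x y - (g x y + phi * L_op g x y)) <= 2 * M * K ^ 2 * phi ^ 2.
Proof.
  intros hM hK h hphi.
  assert (hex := ex_exp_L_small g phi x y M K hM hK h ltac:(lra)).
  assert (hb := exp_L_term_bound g phi x y M K hM hK h).
  assert (hq : 0 <= Rabs phi * K) by (apply Rmult_le_pos; [apply Rabs_pos|easy]).
  unfold exp_L. rewrite Series_incr_1 by exact hex.
  rewrite Series_incr_1 by (now apply (ex_series_incr_1 (exp_L_term phi g x y))).
  set (r := Series _).
  replace (exp_L_term phi g x y 0 + (exp_L_term phi g x y 1 + r)
           - (g x y + phi * L_op g x y)) with r
    by (unfold exp_L_term; simpl; field).
  set (b := fun n => M * (Rabs phi * K) ^ 2 * (1 / 2) ^ n).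
  assert (hterm : forall n, Rabs (exp_L_term phi g x y (S (S n))) <= b n).
  { intros n. eapply Rle_trans; [apply hb|]. unfold b.
    replace (S (S n)) with (2 + n)%nat by lia. rewrite pow_add, <- Rmult_assoc.
    apply Rmult_le_compat_l.
    - apply Rmult_le_pos; [easy|now apply pow_le].
    - apply pow_incr. lra. }
  assert (hbex : ex_series b) by (apply ex_series_scal_geom; lra).
  eapply Rle_trans; [exact (Series_abs_le _ b hterm hbex)|].
  unfold b. rewrite Series_scal_l, Series_geom by (rewrite Rabs_pos_eq; lra).
  rewrite Rpow_mult_distr, RPow_abs, (Rabs_pos_eq (phi ^ 2)) by apply pow2_ge_0.
  apply Req_le. field.
Qed.

(** * Double power series *)

Lemma is_derive_of_quadratic (f : R -> R) (x l C : R) (d : posreal) :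
  (forall t, Rabs (t - x) < d -> Rabs (f t - f x - (t - x) * l) <= C * (t - x) ^ 2) ->
  is_derive f x l.
Proof.
  intros h. apply is_derive_Reals. intros eps heps.
  assert (hC : 0 <= Rabs C) by apply Rabs_pos.
  assert (hp : 0 < Rmin d (eps / (Rabs C + 1))).
  { apply Rmin_pos; [apply cond_pos|]. apply Rdiv_lt_0_compat; lra. }
  exists (mkposreal _ hp). intros e he hlt; simpl in hlt.
  assert (l1 := Rmin_l d (eps / (Rabs C + 1))).
  assert (l2 := Rmin_r d (eps / (Rabs C + 1))).
  assert (k := h (x + e)). replace (x + e - x) with e in k by ring.
  specialize (k ltac:(lra)).
  replace ((f (x + e) - f x) / e - l) with ((f (x + e) - f x - e * l) / e) by (field; easy).
  assert (hae : 0 < Rabs e) by now apply Rabs_pos_lt.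
  rewrite Rabs_div by easy.
  apply Rmult_lt_reg_r with (Rabs e); [easy|].
  unfold Rdiv. rewrite Rmult_assoc, Rinv_l, Rmult_1_r by lra.
  eapply Rle_lt_trans; [exact k|].
  replace (e ^ 2) with (Rabs e * Rabs e).
  2: { rewrite <- Rabs_mult, Rabs_pos_eq; [ring|]. assert (q := Rle_0_sqr e). exact q. }
  rewrite <- Rmult_assoc. apply Rmult_lt_compat_r; [easy|].
  assert (hCl := Rle_abs C).
  apply Rle_lt_trans with (Rabs C * Rabs e); [apply Rmult_le_compat_r; lra|].
  apply Rle_lt_trans with ((Rabs C + 1) * Rabs e); [lra|].
  replace eps with ((Rabs C + 1) * (eps / (Rabs C + 1))) by (field; lra).
  apply Rmult_lt_compat_l; lra.
Qed.

(** Each term differs from its linear part at [x] by at most [b n] (t - x)^2, because [b n] bounds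
    its second derivative; the summed errors are still quadratic in t - x. *)
Lemma is_derive_Series (u v w : nat -> R -> R) (b : nat -> R) (x : R) (d : posreal) :
  (forall n t, Rabs (t - x) < d -> is_derive (u n) t (v n t)) ->
  (forall n t, Rabs (t - x) < d -> is_derive (v n) t (w n t)) ->
  (forall n t, Rabs (t - x) < d -> Rabs (w n t) <= b n) ->
  ex_series b ->
  (forall t, Rabs (t - x) < d -> ex_series (fun n => u n t)) ->
  ex_series (fun n => v n x) ->
  is_derive (fun t => Series (fun n => u n t)) x (Series (fun n => v n x)).
Proof.
  intros hu hv hw hb hsu hsv.
  assert (hx : Rabs (x - x) < d) by (rewrite Rminus_diag, Rabs_R0; apply cond_pos).
  apply is_derive_of_quadratic with (Series b) d.
  intros t ht.
  rewrite <- Series_scal_l, <- Series_minus by auto.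
  assert (hsv' : ex_series (fun n => (t - x) * v n x)).
  { now apply (ex_series_scal (V := R_NormedModule)). }
  rewrite <- Series_minus; [|now apply (ex_series_minus (V := R_NormedModule)); auto|easy].
  rewrite <- Series_scal_r.
  apply Series_abs_le.
  - intros n.
    assert (hb0 : 0 <= b n) by (eapply Rle_trans; [apply Rabs_pos|now apply (hw n x)]).
    replace (u n t - u n x - (t - x) * v n x)
      with ((u n t - t * v n x) - (u n x - x * v n x)) by ring.
    replace (b n * (t - x) ^ 2) with (b n * Rabs (t - x) * Rabs (t - x)).
    2: { rewrite Rmult_assoc, <- Rabs_mult, Rabs_pos_eq; [ring|].
         assert (q := Rle_0_sqr (t - x)). exact q. }
    apply (bounded_variation (fun s => u n s - s * v n x) (fun s => v n s - 1 * v n x)).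
    intros s hs. split.
    + apply @is_derive_minus; [apply hu; lra|].
      apply (is_derive_ext (fun s => scal s (v n x))); [easy|].
      apply @is_derive_scal_l. apply @is_derive_id.
    + rewrite Rmult_1_l.
      apply Rle_trans with (b n * Rabs (s - x)); [|now apply Rmult_le_compat_l].
      apply (abs_sub_le_of_derive (v n) (w n) (b n) x s d); [|lra].
      intros; split; auto.
  - apply (ex_series_ext (fun n => (t - x) ^ 2 * b n)); [intros; simpl; ring|].
    now apply (ex_series_scal (V := R_NormedModule)).
Qed.

Definition hpoly (c : nat -> nat -> R) (n : nat) (h k : R) : R :=
  sum_n (fun i => c i (n - i)%nat * h ^ i * k ^ (n - i)) n.

(** Differentiation lowers the degree of a homogeneous polynomial by one. The shift puts the
    derivative of the part of degree n back at index n, with 0 for the constant part. *)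
Definition shift_seq (z : nat -> R) (n : nat) : R :=
  match n with O => 0 | S m => z m end.

(* Coefficients of the partial derivative of order (p, q) of the double power
   series with coefficients [c]. *)
Definition dcoef (c : nat -> nat -> R) (p q i j : nat) : R :=
  c (i + p)%nat (j + q)%nat * (INR (fact (i + p)) / INR (fact i))
  * (INR (fact (j + q)) / INR (fact j)).

Lemma sum_n_first (a : nat -> R) (n : nat) :
  sum_n a (S n) = a 0%nat + sum_n (fun i => a (S i)) n.
Proof.
  induction n as [|n IH].
  - rewrite sum_Sn, !sum_O. reflexivity.
  - rewrite sum_Sn, IH, (sum_Sn (fun i => a (S i))). apply Rplus_assoc.
Qed.

Lemma sum_n_R_ext (a b : nat -> R) (n : nat) :
  (forall i, (i <= n)%nat -> a i = b i) -> sum_n a n = sum_n b n.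
Proof. exact (sum_n_ext_loc a b n). Qed.

Lemma hpoly_ext (c c' : nat -> nat -> R) (n : nat) (h k : R) :
  (forall i j, c i j = c' i j) -> hpoly c n h k = hpoly c' n h k.
Proof. intros e. apply sum_n_R_ext; intros i _. now rewrite e. Qed.

Lemma shift_seq_ext (z z' : nat -> R) (n : nat) :
  (forall m, z m = z' m) -> shift_seq z n = shift_seq z' n.
Proof. intros e. now destruct n; simpl. Qed.

Lemma is_derive_monomial (c K h : R) (i : nat) :
  is_derive (fun t => c * t ^ i * K) h (c * (INR i * h ^ pred i) * K).
Proof. auto_derive; [easy|]. ring. Qed.

Lemma is_derive_hpoly_1 (c : nat -> nat -> R) (n : nat) (h k : R) :
  is_derive (fun t => hpoly c n t k) h
    (shift_seq (fun m => hpoly (fun i j => INR (S i) * c (S i) j) m h k) n).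
Proof.
  unfold hpoly.
  evar_last.
  - apply (is_derive_sum_n (V := R_NormedModule)
      (fun i t => c i (n - i)%nat * t ^ i * k ^ (n - i)) n h).
    intros i _. apply is_derive_monomial.
  - destruct n as [|n].
    + rewrite sum_O. simpl. ring.
    + rewrite sum_n_first. unfold shift_seq.
      replace (c 0%nat (S n - 0)%nat * (INR 0 * h ^ pred 0) * k ^ (S n - 0)) with 0
        by (simpl INR; ring).
      rewrite Rplus_0_l. apply sum_n_R_ext. intros i _.
      change (S n - S i)%nat with (n - i)%nat. simpl pred. ring.
Qed.

Lemma is_derive_hpoly_2 (c : nat -> nat -> R) (n : nat) (h k : R) :
  is_derive (fun t => hpoly c n h t) k
    (shift_seq (fun m => hpoly (fun i j => INR (S j) * c i (S j)) m h k) n).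
Proof.
  unfold hpoly.
  evar_last.
  - apply (is_derive_sum_n (V := R_NormedModule)
      (fun i t => c i (n - i)%nat * h ^ i * t ^ (n - i)) n k
      (fun i => c i (n - i)%nat * h ^ i * (INR (n - i) * k ^ pred (n - i)))).
    intros i _.
    apply (is_derive_ext (fun t => c i (n - i)%nat * h ^ i * t ^ (n - i) * 1));
      [intros; apply Rmult_1_r|].
    replace (c i (n - i)%nat * h ^ i * (INR (n - i) * k ^ pred (n - i)))
      with (c i (n - i)%nat * h ^ i * (INR (n - i) * k ^ pred (n - i)) * 1) by ring.
    apply is_derive_monomial.
  - destruct n as [|n].
    + rewrite sum_O. simpl. ring.
    + rewrite sum_Sn. unfold shift_seq. rewrite Nat.sub_diag. unfold plus; simpl plus.
      replace (c (S n) 0%nat * h ^ S n * (INR 0 * k ^ pred 0)) with 0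
        by (simpl INR; ring).
      change (sum_n (fun i => c i (S n - i)%nat * h ^ i
                  * (INR (S n - i) * k ^ pred (S n - i))) n + 0 =
        sum_n (fun i => INR (S (n - i)) * c i (S (n - i)) * h ^ i * k ^ (n - i)) n).
      rewrite Rplus_0_r. apply sum_n_R_ext. intros i hi.
      replace (S n - i)%nat with (S (n - i)) by lia. simpl pred. ring.
Qed.

Lemma dcoef_succ_1 (c : nat -> nat -> R) (p q i j : nat) :
  INR (S i) * dcoef c p q (S i) j = dcoef c (S p) q i j.
Proof.
  unfold dcoef. replace (i + S p)%nat with (S i + p)%nat by lia.
  rewrite (INR_fact_S i).
  assert (h1 := INR_fact_pos i). assert (h2 := INR_fact_pos j).
  assert (h3 : 0 < INR (S i)) by (apply lt_0_INR; lia).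
  generalize dependent (INR (S i)). intros. field. lra.
Qed.

Lemma dcoef_succ_2 (c : nat -> nat -> R) (p q i j : nat) :
  INR (S j) * dcoef c p q i (S j) = dcoef c p (S q) i j.
Proof.
  unfold dcoef. replace (j + S q)%nat with (S j + q)%nat by lia.
  rewrite (INR_fact_S j).
  assert (h1 := INR_fact_pos i). assert (h2 := INR_fact_pos j).
  assert (h3 : 0 < INR (S j)) by (apply lt_0_INR; lia).
  generalize dependent (INR (S j)). intros. field. lra.
Qed.

Lemma is_derive_hpoly_dcoef_1 (c : nat -> nat -> R) (p q n : nat) (h k : R) :
  is_derive (fun t => hpoly (dcoef c p q) n t k) h
    (shift_seq (fun m => hpoly (dcoef c (S p) q) m h k) n).
Proof.
  evar_last; [apply is_derive_hpoly_1|].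
  apply shift_seq_ext; intros m. apply hpoly_ext; intros; apply dcoef_succ_1.
Qed.

Lemma is_derive_hpoly_dcoef_2 (c : nat -> nat -> R) (p q n : nat) (h k : R) :
  is_derive (fun t => hpoly (dcoef c p q) n h t) k
    (shift_seq (fun m => hpoly (dcoef c p (S q)) m h k) n).
Proof.
  evar_last; [apply is_derive_hpoly_2|].
  apply shift_seq_ext; intros m. apply hpoly_ext; intros; apply dcoef_succ_2.
Qed.

Lemma fact_ratio_le (i p : nat) :
  0 <= INR (fact (i + p)) / INR (fact i) <= INR (fact p) * 2 ^ (i + p).
Proof.
  assert (h := fact_add_le 1 i p ltac:(lra)).
  rewrite pow1, Rmult_1_r in h. replace (1 + 1) with 2 in h by ring.
  assert (h1 := INR_fact_pos i). assert (h2 := INR_fact_pos (i + p)).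
  split.
  - apply Rlt_le, Rdiv_lt_0_compat; easy.
  - apply Rmult_le_reg_l with (INR (fact i)); [easy|].
    replace (INR (fact i) * (INR (fact (i + p)) / INR (fact i))) with (INR (fact (i + p)))
      by (field; lra). lra.
Qed.

(** The quotients of factorials are at most p! 2^(i+p) and q! 2^(j+q); the powers of 2 turn [rho]
    into [2 * rho]. *)
Lemma dcoef_bound (c : nat -> nat -> R) (M rho : R) : 0 <= M -> 0 <= rho ->
  (forall i j, Rabs (c i j) <= M * rho ^ (i + j)) ->
  forall p q i j, Rabs (dcoef c p q i j)
    <= M * INR (fact (p + q)) * (2 * rho) ^ (p + q) * (2 * rho) ^ (i + j).
Proof.
  intros hM hr hc p q i j. unfold dcoef.
  destruct (fact_ratio_le i p) as [a1 a2]. destruct (fact_ratio_le j q) as [b1 b2].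
  rewrite !Rabs_mult, (Rabs_pos_eq (_ / INR (fact i))), (Rabs_pos_eq (_ / INR (fact j))) by easy.
  apply Rle_trans with (M * rho ^ (i + p + (j + q)) * (INR (fact p) * 2 ^ (i + p))
                        * (INR (fact q) * 2 ^ (j + q))).
  - apply Rmult_le_compat; try easy.
    + apply Rmult_le_pos; [apply Rabs_pos|easy].
    + apply Rmult_le_compat; try easy. apply Rabs_pos.
  - apply Rle_trans with (M * (INR (fact p) * INR (fact q)) * (2 * rho) ^ (p + q)
                          * (2 * rho) ^ (i + j)).
    + apply Req_le. rewrite !Rpow_mult_distr, !pow_add. ring.
    + assert (h := fact_mult_le p q).
      assert (0 <= 2 * rho) by lra.
      apply Rmult_le_compat_r; [now apply pow_le|].
      apply Rmult_le_compat_r; [now apply pow_le|].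
      now apply Rmult_le_compat_l.
Qed.

Lemma abs_sum_n_le (a : nat -> R) (B : R) (n : nat) :
  (forall i, (i <= n)%nat -> Rabs (a i) <= B) -> Rabs (sum_n a n) <= INR (S n) * B.
Proof.
  induction n as [|n IH]; intros h.
  - rewrite sum_O. simpl. rewrite Rmult_1_l. now apply h.
  - rewrite sum_Sn, (S_INR (S n)). eapply Rle_trans; [apply Rabs_triang|].
    assert (h1 := IH ltac:(intros; apply h; lia)). assert (h2 := h (S n) ltac:(lia)). lra.
Qed.

Lemma INR_S_le_pow2 (n : nat) : INR (S n) <= 2 ^ n.
Proof.
  induction n as [|n IH]; [simpl; lra|].
  rewrite S_INR. simpl pow. assert (1 <= 2 ^ n) by (apply pow_R1_Rle; lra). lra.
Qed.

(** There are n + 1 <= 2^n monomials of degree n, each at most M rho^n/(4 rho)^n = M/4^n. *)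
Lemma hpoly_bound (c : nat -> nat -> R) (M rho h k : R) : 0 <= M -> 0 < rho ->
  (forall i j, Rabs (c i j) <= M * rho ^ (i + j)) ->
  Rabs h <= / (4 * rho) -> Rabs k <= / (4 * rho) ->
  forall n, Rabs (hpoly c n h k) <= M * (1 / 2) ^ n.
Proof.
  intros hM hr hc hh hk n.
  assert (h0 := Rabs_pos h). assert (k0 := Rabs_pos k).
  assert (hs : 0 < / (4 * rho)) by (apply Rinv_0_lt_compat; lra).
  eapply Rle_trans; [apply abs_sum_n_le with (B := M * rho ^ n * (/ (4 * rho)) ^ n)|].
  - intros i hi. rewrite !Rabs_mult, <- !RPow_abs.
    assert (e : n = (i + (n - i))%nat) by lia.
    replace ((/ (4 * rho)) ^ n) with ((/ (4 * rho)) ^ i * (/ (4 * rho)) ^ (n - i))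
      by (rewrite <- pow_add; f_equal; lia).
    rewrite Rmult_assoc.
    apply Rmult_le_compat; [apply Rabs_pos|apply Rmult_le_pos; now apply pow_le| |].
    + rewrite e at 2. apply hc.
    + apply Rmult_le_compat; try (now apply pow_le); apply pow_incr; lra.
  - assert (h2 := INR_S_le_pow2 n).
    apply Rle_trans with (2 ^ n * (M * rho ^ n * (/ (4 * rho)) ^ n)).
    + apply Rmult_le_compat_r; [|easy]. repeat apply Rmult_le_pos; try apply pow_le; lra.
    + apply Req_le.
      replace (1 / 2) with (2 * (rho * / (4 * rho))) by (field; lra).
      rewrite !Rpow_mult_distr. ring.
Qed.

Lemma shift_seq_bound (z : nat -> R) (B : R) : 0 <= B ->
  (forall n, Rabs (z n) <= B * (1 / 2) ^ n) ->
  forall n, Rabs (shift_seq z n) <= 2 * B * (1 / 2) ^ n.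
Proof.
  intros hB h [|n]; simpl.
  - rewrite Rabs_R0. lra.
  - replace (2 * B * (1 / 2 * (1 / 2) ^ n)) with (B * (1 / 2) ^ n) by field. apply h.
Qed.

Definition dser (c : nat -> nat -> R) (h k : R) : R := Series (fun n => hpoly c n h k).

Lemma Series_shift_seq (z : nat -> R) : ex_series z -> Series (shift_seq z) = Series z.
Proof.
  intros h. rewrite Series_incr_1; [simpl; apply Rplus_0_l|].
  now apply (ex_series_incr_1 (V := R_NormedModule) (shift_seq z)).
Qed.

Lemma ex_series_half (z : nat -> R) (B : R) :
  (forall n, Rabs (z n) <= B * (1 / 2) ^ n) -> ex_series z.
Proof.
  intros h. apply @ex_series_le with (b := fun n => B * (1 / 2) ^ n); [exact h|].
  apply ex_series_scal_geom; lra.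
Qed.

Definition dcoef_const (M rho : R) (p q : nat) : R :=
  M * INR (fact (p + q)) * (2 * rho) ^ (p + q).

Lemma dcoef_const_ge_0 (M rho : R) (p q : nat) : 0 <= M -> 0 < rho -> 0 <= dcoef_const M rho p q.
Proof.
  intros hM hrho. unfold dcoef_const. assert (h := INR_fact_pos (p + q)).
  repeat apply Rmult_le_pos; try apply pow_le; lra.
Qed.

Lemma hpoly_dcoef_bound (c : nat -> nat -> R) (M rho : R) (p q n : nat) (h k : R) :
  0 <= M -> 0 < rho -> (forall i j, Rabs (c i j) <= M * rho ^ (i + j)) ->
  Rabs h <= / (4 * (2 * rho)) -> Rabs k <= / (4 * (2 * rho)) ->
  Rabs (hpoly (dcoef c p q) n h k) <= dcoef_const M rho p q * (1 / 2) ^ n.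
Proof.
  intros hM hrho hc hh hk. apply hpoly_bound with (2 * rho); try easy;
    [now apply dcoef_const_ge_0|lra|].
  intros i j. apply dcoef_bound; [easy|lra|easy].
Qed.

Lemma Rabs_le_of_sub (h t s : R) : Rabs (t - h) < s - Rabs h -> Rabs t <= s.
Proof.
  intros ht. replace t with ((t - h) + h) by ring.
  eapply Rle_trans; [apply Rabs_triang|lra].
Qed.

Lemma is_derive_dser_1 (c : nat -> nat -> R) (M rho : R) (p q : nat) (h k : R) :
  0 <= M -> 0 < rho -> (forall i j, Rabs (c i j) <= M * rho ^ (i + j)) ->
  Rabs h < / (4 * (2 * rho)) -> Rabs k < / (4 * (2 * rho)) ->
  is_derive (fun t => dser (dcoef c p q) t k) h (dser (dcoef c (S p) q) h k).
Proof.
  intros hM hrho hc hh hk. set (s := / (4 * (2 * rho))) in *.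
  set (B := dcoef_const M rho).
  assert (hd : 0 < s - Rabs h) by lra.
  assert (bd : forall p t, Rabs (t - h) < s - Rabs h -> forall n,
    Rabs (hpoly (dcoef c p q) n t k) <= B p q * (1 / 2) ^ n).
  { intros p' t ht n. apply hpoly_dcoef_bound; try assumption;
      [now apply Rabs_le_of_sub with h|now apply Rlt_le]. }
  assert (hz : Rabs (h - h) < s - Rabs h) by (rewrite Rminus_diag, Rabs_R0; lra).
  unfold dser.
  (* The shift aligns the two series, so that the n-th term of the second is the derivative of the
     n-th term of the first. *)
  rewrite <- (Series_shift_seq (fun n => hpoly (dcoef c (S p) q) n h k))
    by (apply ex_series_half with (B (S p) q); now apply bd).
  (* The second derivatives are shifted twice, and each shift costs a factor 2 in the geometric
     bound. *)
  apply is_derive_Series with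
    (u := fun n t => hpoly (dcoef c p q) n t k)
    (v := fun n t => shift_seq (fun m => hpoly (dcoef c (S p) q) m t k) n)
    (w := fun n t => shift_seq (fun m =>
            shift_seq (fun l => hpoly (dcoef c (S (S p)) q) l t k) m) n)
    (b := fun n => 2 * (2 * B (S (S p)) q) * (1 / 2) ^ n) (d := mkposreal _ hd).
  - intros. apply is_derive_hpoly_dcoef_1.
  - intros [|n] t _; simpl; [apply @is_derive_const|]. apply is_derive_hpoly_dcoef_1.
  - intros n t ht. assert (hB : 0 <= B (S (S p)) q) by now apply dcoef_const_ge_0.
    apply shift_seq_bound; [lra|]. intros m. apply shift_seq_bound; [lra|]. now apply bd.
  - apply ex_series_scal_geom; lra.
  - intros t ht. apply ex_series_half with (B p q). now apply bd.
  - apply ex_series_half with (2 * B (S p) q).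
    apply shift_seq_bound; [now apply dcoef_const_ge_0|]. now apply bd.
Qed.

Lemma is_derive_dser_2 (c : nat -> nat -> R) (M rho : R) (p q : nat) (h k : R) :
  0 <= M -> 0 < rho -> (forall i j, Rabs (c i j) <= M * rho ^ (i + j)) ->
  Rabs h < / (4 * (2 * rho)) -> Rabs k < / (4 * (2 * rho)) ->
  is_derive (fun t => dser (dcoef c p q) h t) k (dser (dcoef c p (S q)) h k).
Proof.
  intros hM hrho hc hh hk. set (s := / (4 * (2 * rho))) in *.
  set (B := dcoef_const M rho).
  assert (hd : 0 < s - Rabs k) by lra.
  assert (bd : forall q t, Rabs (t - k) < s - Rabs k -> forall n,
    Rabs (hpoly (dcoef c p q) n h t) <= B p q * (1 / 2) ^ n).
  { intros q' t ht n. apply hpoly_dcoef_bound; try assumption;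
      [now apply Rlt_le|now apply Rabs_le_of_sub with k]. }
  assert (hz : Rabs (k - k) < s - Rabs k) by (rewrite Rminus_diag, Rabs_R0; lra).
  unfold dser.
  rewrite <- (Series_shift_seq (fun n => hpoly (dcoef c p (S q)) n h k))
    by (apply ex_series_half with (B p (S q)); now apply bd).
  apply is_derive_Series with
    (u := fun n t => hpoly (dcoef c p q) n h t)
    (v := fun n t => shift_seq (fun m => hpoly (dcoef c p (S q)) m h t) n)
    (w := fun n t => shift_seq (fun m =>
            shift_seq (fun l => hpoly (dcoef c p (S (S q))) l h t) m) n)
    (b := fun n => 2 * (2 * B p (S (S q))) * (1 / 2) ^ n) (d := mkposreal _ hd).
  - intros. apply is_derive_hpoly_dcoef_2.
  - intros [|n] t _; simpl; [apply @is_derive_const|]. apply is_derive_hpoly_dcoef_2.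
  - intros n t ht. assert (hB : 0 <= B p (S (S q))) by now apply dcoef_const_ge_0.
    apply shift_seq_bound; [lra|]. intros m. apply shift_seq_bound; [lra|]. now apply bd.
  - apply ex_series_scal_geom; lra.
  - intros t ht. apply ex_series_half with (B p q). now apply bd.
  - apply ex_series_half with (2 * B p (S q)).
    apply shift_seq_bound; [now apply dcoef_const_ge_0|]. now apply bd.
Qed.

Lemma dser_bound (c : nat -> nat -> R) (M rho : R) (p q : nat) (h k : R) :
  0 <= M -> 0 < rho -> (forall i j, Rabs (c i j) <= M * rho ^ (i + j)) ->
  Rabs h < / (4 * (2 * rho)) -> Rabs k < / (4 * (2 * rho)) ->
  Rabs (dser (dcoef c p q) h k) <= 2 * M * INR (fact (p + q)) * (2 * rho) ^ (p + q).
Proof.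
  intros hM hrho hc hh hk. set (s := / (4 * (2 * rho))) in *.
  set (B := dcoef_const M rho).
  eapply Rle_trans; [apply Series_abs_le with (b := fun n => B p q * (1 / 2) ^ n)|].
  - intros n. apply hpoly_dcoef_bound; try assumption; now apply Rlt_le.
  - apply ex_series_scal_geom; lra.
  - rewrite Series_scal_l, Series_geom by (rewrite Rabs_pos_eq; lra).
    apply Req_le. unfold B, dcoef_const. field.
Qed.

Lemma is_derive_translate (F : R -> R) (a x l : R) :
  is_derive F (x - a) l -> is_derive (fun u => F (u - a)) x l.
Proof.
  intros h. evar_last.
  - apply (is_derive_comp F (fun u => u - a) x l 1 h). auto_derive; [easy|ring].
  - unfold scal; simpl; unfold mult; simpl. ring.
Qed.

Lemma sum_n_term_le (a : nat -> R) (n i : nat) :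
  (forall i, 0 <= a i) -> (i <= n)%nat -> a i <= sum_n a n.
Proof.
  intros ha. induction n as [|n IH]; intros hi.
  - replace i with 0%nat by lia. rewrite sum_O. lra.
  - rewrite sum_Sn. unfold plus; simpl.
    destruct (Nat.eq_dec i (S n)) as [e|ne].
    + subst i.
      assert (0 <= sum_n a n).
      { clear IH hi. induction n as [|n IH]; [rewrite sum_O; apply ha|].
        rewrite sum_Sn. unfold plus; simpl. assert (k := ha (S n)). lra. }
      lra.
    + assert (h := IH ltac:(lia)). assert (k := ha (S n)). lra.
Qed.

(** Absolute convergence at one point off the axes bounds the coefficients geometrically, after
    which the double series can be differentiated term by term on a smaller box. *)
Lemma analytic_at_regular (f : R -> R -> R) (a b : R) : analytic_at f a b -> regular f a b.
Proof.
  intros [c [r h]].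
  assert (hr := cond_pos r).
  set (r0 := r / 2).
  assert (hr0 : 0 < r0 < r) by (unfold r0; lra).
  (* At h = k = [r0] the absolute monomials of degree n sum to at most [M], so each of them is at
     most [M], which gives |c i j| <= M/r0^(i+j). *)
  destruct (h r0 r0) as [hex _]; try (rewrite Rabs_pos_eq; lra).
  destruct (ex_series_bounded _ hex) as [M hM].
  assert (hM0 : 0 <= M) by (eapply Rle_trans; [apply Rabs_pos|apply (hM 0%nat)]).
  set (rho := / r0).
  assert (hrho : 0 < rho) by (apply Rinv_0_lt_compat; lra).
  assert (hc : forall i j, Rabs (c i j) <= M * rho ^ (i + j)).
  { intros i j.
    assert (hs := hM (i + j)%nat).
    assert (ht := sum_n_term_le
      (fun k => Rabs (c k (i + j - k)%nat * r0 ^ k * r0 ^ (i + j - k))) (i + j) i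
      (fun k => Rabs_pos _) ltac:(lia)). cbv beta in ht.
    assert (hle := Rle_trans _ _ _ ht (Rle_trans _ _ _ (Rle_abs _) hs)).
    replace (i + j - i)%nat with j in hle by lia.
    rewrite Rmult_assoc, <- pow_add, Rabs_mult, <- RPow_abs, (Rabs_pos_eq r0) in hle by lra.
    assert (hp : 0 < r0 ^ (i + j)) by (apply pow_lt; lra).
    apply Rmult_le_reg_r with (r0 ^ (i + j)); [easy|].
    unfold rho. rewrite pow_inv, Rmult_assoc, Rinv_l by lra. lra. }
  (* The 2 is the loss of [dcoef_bound], the 4 is the radius required by [hpoly_bound]; the result
     is [r0]/8. *)
  set (s := / (4 * (2 * rho))).
  assert (hs : 0 < s) by (apply Rinv_0_lt_compat; lra).
  assert (hsr : s < r).
  { unfold s, rho. replace (/ (4 * (2 * / r0))) with (r0 / 8) by (field; lra). lra. }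
  apply regular_of_family with (d := mkposreal s hs) (M := 2 * M) (rho := 2 * rho)
    (G := fun p q x y => dser (dcoef c p q) (x - a) (y - b)); try lra; simpl.
  - intros u v [hu hv].
    destruct (h (u - a) (v - b)) as [_ hf]; try lra.
    apply is_series_unique in hf.
    replace (a + (u - a)) with u in hf by ring. replace (b + (v - b)) with v in hf by ring.
    rewrite <- hf. apply Series_ext; intros n. unfold hpoly. apply sum_n_R_ext; intros i _.
    unfold dcoef. rewrite !Nat.add_0_r.
    assert (k1 := INR_fact_pos i). assert (k2 := INR_fact_pos (n - i)). field. lra.
  - intros u v [hu hv]. split.
    + intros i j. split.
      * apply (is_derive_translate (fun x => dser (dcoef c i j) x (v - b))).
        now apply (is_derive_dser_1 c M rho).
      * apply (is_derive_translate (fun y => dser (dcoef c i j) (u - a) y)).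
        now apply (is_derive_dser_2 c M rho).
    + intros i j. now apply (dser_bound c M rho).
Qed.

(** * Products and parameter integrals *)

(** The family is only re-indexed. Splitting (i+j+p+q)! by [fact_add_le] with [e = 1] moves (i+j)!
    into [M] and doubles [rho]. *)
Lemma regular_pderiv (g : R -> R -> R) (x y : R) (i j : nat) :
  regular g x y -> regular (pderiv g i j) x y.
Proof.
  intros [d [M [rho [hM [hr h]]]]].
  apply regular_of_family with (d := d) (M := M * INR (fact (i + j)) * (2 * rho) ^ (i + j))
    (rho := 2 * rho) (G := fun p q => pderiv g (p + i) (q + j)).
  - assert (hf := INR_fact_pos (i + j)).
    repeat apply Rmult_le_pos; try apply pow_le; lra.
  - lra.
  - easy.
  - intros u v hb. destruct (h u v hb) as [hs hc]. split.
    + intros p q. apply (hs (p + i)%nat (q + j)%nat).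
    + intros p q. eapply Rle_trans; [apply hc|].
      replace (p + i + (q + j))%nat with (i + j + (p + q))%nat by lia.
      assert (hf := fact_add_le 1 (i + j) (p + q) ltac:(lra)).
      rewrite pow1, Rmult_1_r in hf. replace (1 + 1) with 2 in hf by ring.
      apply Rle_trans with (M * (INR (fact (i + j)) * INR (fact (p + q)) * 2 ^ (i + j + (p + q)))
                            * rho ^ (i + j + (p + q))).
      * apply Rmult_le_compat_r; [now apply pow_le|]. now apply Rmult_le_compat_l.
      * apply Req_le. rewrite !pow_add, !Rpow_mult_distr. ring.
Qed.

Lemma regular_scal (c : R) (g : R -> R -> R) (x y : R) :
  regular g x y -> regular (fun u v => c * g u v) x y.
Proof.
  intros [d [M [rho [hM [hr h]]]]].
  apply regular_of_family with (d := d) (M := Rabs c * M) (rho := rho)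
    (G := fun p q u v => c * pderiv g p q u v); try easy.
  - apply Rmult_le_pos; [apply Rabs_pos|easy].
  - intros u v hb. destruct (h u v hb) as [hs hc]. split.
    + intros p q. split; apply is_derive_scal, hs.
    + intros p q. rewrite Rabs_mult.
      apply Rle_trans with (Rabs c * (M * INR (fact (p + q)) * rho ^ (p + q))).
      * apply Rmult_le_compat_l; [apply Rabs_pos|apply hc].
      * apply Req_le; ring.
Qed.

(* [mult_family p G m k i j] is the [m]-th derivative in the first variable of
   [p k * G i j], as a sum of 2^m products. *)
Fixpoint mult_family (p : nat -> R -> R) (G : nat -> nat -> R -> R -> R)
    (m k i j : nat) (u v : R) : R :=
  match m with
  | O => p k u * G i j u v
  | S m => mult_family p G m (S k) i j u v + mult_family p G m k (S i) j u v
  end.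

Lemma is_derive_mult_family (p : nat -> R -> R) (G : nat -> nat -> R -> R -> R) (u v : R) :
  (forall k, is_derive (p k) u (p (S k) u)) -> smooth_at G u v ->
  forall m k i j,
    is_derive (fun w => mult_family p G m k i j w v) u (mult_family p G (S m) k i j u v) /\
    is_derive (fun w => mult_family p G m k i j u w) v (mult_family p G m k i (S j) u v).
Proof.
  intros hp hG. induction m as [|m IH]; intros k i j.
  - simpl. split.
    + evar_last; [apply @is_derive_mult; [apply hp|apply (hG i j)|intros; apply Rmult_comm]|].
      reflexivity.
    + apply is_derive_scal, (hG i j).
  - split.
    + simpl mult_family at 1. apply @is_derive_plus; apply IH.
    + simpl. apply @is_derive_plus; apply IH.
Qed.

(** Each of the 2^m products has total order k+i+j+m, and k! (i+j)! <= (k+i+j)! merges the two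
    factorials. *)
Lemma mult_family_bound (p : nat -> R -> R) (G : nat -> nat -> R -> R -> R)
    (A M s u v : R) : 0 <= A -> 0 <= M -> 0 <= s ->
  (forall k, Rabs (p k u) <= A * INR (fact k) * s ^ k) -> cauchy_at G M s u v ->
  forall m k i j, Rabs (mult_family p G m k i j u v)
    <= A * M * 2 ^ m * INR (fact (k + i + j + m)) * s ^ (k + i + j + m).
Proof.
  intros hA hM hs hp hG. induction m as [|m IH]; intros k i j.
  - simpl mult_family. rewrite Rabs_mult, Nat.add_0_r.
    apply Rle_trans with ((A * INR (fact k) * s ^ k) * (M * INR (fact (i + j)) * s ^ (i + j))).
    + apply Rmult_le_compat; auto using Rabs_pos.
    + replace (k + i + j)%nat with (k + (i + j))%nat by lia.
      assert (h := fact_mult_le k (i + j)).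
      apply Rle_trans with (A * M * (INR (fact k) * INR (fact (i + j))) * s ^ (k + (i + j))).
      * apply Req_le. rewrite (pow_add s k). ring.
      * simpl (2 ^ 0). apply Rmult_le_compat_r; [now apply pow_le|]. rewrite Rmult_1_r.
        apply Rmult_le_compat_l; [now apply Rmult_le_pos|easy].
  - simpl mult_family. eapply Rle_trans; [apply Rabs_triang|].
    assert (h1 := IH (S k) i j). assert (h2 := IH k (S i) j).
    replace (S k + i + j + m)%nat with (k + i + j + S m)%nat in h1 by lia.
    replace (k + S i + j + m)%nat with (k + i + j + S m)%nat in h2 by lia.
    simpl (2 ^ S m). lra.
Qed.

Lemma regular_mult_fst (p : nat -> R -> R) (g : R -> R -> R) (A s x y : R) (d : posreal) :
  0 <= A -> 0 <= s ->
  (forall k u, Rabs (u - x) < d -> is_derive (p k) u (p (S k) u)) ->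
  (forall k u, Rabs (u - x) < d -> Rabs (p k u) <= A * INR (fact k) * s ^ k) ->
  regular g x y -> regular (fun u v => p 0%nat u * g u v) x y.
Proof.
  intros hA hs hp hb [e [M [rho [hM [hr h]]]]].
  assert (hm : 0 < Rmin d e) by (apply Rmin_pos; apply cond_pos).
  (* From here on [S] is a real number and hides the successor. It is a common growth rate for [p]
     and [g]; the final rate is [2 * S] because of the 2^i products in [mult_family]. *)
  set (S := s + rho).
  apply regular_of_family with (d := mkposreal _ hm) (M := A * M) (rho := 2 * S)
    (G := fun i j => mult_family p (pderiv g) i 0%nat 0%nat j).
  - now apply Rmult_le_pos.
  - unfold S; lra.
  - easy.
  - simpl. intros u v hu.
    assert (hu1 : Rabs (u - x) < d) by (eapply Rlt_le_trans; [apply hu|apply Rmin_l]).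
    assert (hu2 : box x y e u v) by (eapply box_le; [apply Rmin_r|exact hu]).
    destruct (h u v hu2) as [hsm hc]. split.
    + intros i j. apply is_derive_mult_family; auto.
    + intros i j. eapply Rle_trans.
      * apply (mult_family_bound p (pderiv g) A M S); try easy; [unfold S; lra| |].
        -- intros k. eapply Rle_trans; [now apply hb|].
           apply Rmult_le_compat_l; [|apply pow_incr; unfold S; lra].
           assert (hf := INR_fact_pos k). apply Rmult_le_pos; lra.
        -- apply cauchy_at_le with M rho; try easy; unfold S; lra.
      * replace (0 + 0 + j + i)%nat with (i + j)%nat by lia.
        rewrite Rpow_mult_distr, pow_add.
        assert (h1 : 1 <= 2 ^ j) by (apply pow_R1_Rle; lra).
        assert (h2 : 0 < 2 ^ i) by (apply pow_lt; lra).
        assert (hf := INR_fact_pos (i + j)).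
        assert (hS : 0 <= S ^ i * S ^ j) by (rewrite <- pow_add; apply pow_le; unfold S; lra).
        replace (A * M * INR (fact (i + j)) * (2 ^ (i + j) * (S ^ i * S ^ j)))
          with (A * M * 2 ^ i * INR (fact (i + j)) * (S ^ i * S ^ j) * 2 ^ j)
          by (rewrite pow_add; ring).
        rewrite <- (Rmult_1_r (A * M * 2 ^ i * INR (fact (i + j)) * (S ^ i * S ^ j))) at 1.
        apply Rmult_le_compat_l; [|easy].
        apply Rmult_le_pos; [|easy]. repeat apply Rmult_le_pos; lra.
Qed.

(** The falling factorial beta (beta - 1) ... (beta - k + 1), the coefficient in the k-th derivative
    of u^beta. *)
Fixpoint falling (beta : R) (k : nat) : R :=
  match k with O => 1 | S k => falling beta k * (beta - INR k) end.

(** For beta in [0, 1] the factor beta - k has absolute value at most k + 1. *)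
Lemma falling_bound (beta : R) (k : nat) : 0 <= beta <= 1 ->
  Rabs (falling beta k) <= INR (fact k).
Proof.
  intros hb. induction k as [|k IH].
  - simpl. rewrite Rabs_R1. lra.
  - simpl falling. rewrite Rabs_mult, INR_fact_S, S_INR, Rmult_comm.
    apply Rmult_le_compat; auto using Rabs_pos.
    assert (h := pos_INR k). apply Rabs_le. lra.
Qed.

Lemma is_derive_falling_power (beta z : R) (k : nat) : 0 < z ->
  is_derive (fun u => falling beta k * Rpower u (beta - INR k)) z
            (falling beta (S k) * Rpower z (beta - INR (S k))).
Proof.
  intros hz. rewrite S_INR. simpl falling.
  replace (falling beta k * (beta - INR k) * Rpower z (beta - (INR k + 1)))
    with (falling beta k * ((beta - INR k) * Rpower z (beta - INR k - 1))).
  - apply is_derive_scal. apply is_derive_Reals. now apply derivable_pt_lim_power.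
  - replace (beta - (INR k + 1)) with (beta - INR k - 1) by ring. ring.
Qed.

Lemma regular_mult_power (beta : R) (g : R -> R -> R) (x y : R) : 0 <= beta <= 1 -> 0 < x ->
  regular g x y -> regular (fun u v => Rpower u beta * g u v) x y.
Proof.
  intros hb hx hg.
  assert (hd : 0 < x / 2) by lra.
  apply regular_ext with
    (f := fun u v => falling beta 0 * Rpower u (beta - INR 0) * g u v) (d := mkposreal _ hd).
  { intros u v _. simpl. now rewrite Rminus_0_r, Rmult_1_l. }
  (* For |u - x| < x/2 one has x/2 < u < 2x; hence u^beta <= (2x)^beta, and each derivative costs at
     most 1/u <= 2/x besides its factor in [falling]. *)
  apply (regular_mult_fst (fun k u => falling beta k * Rpower u (beta - INR k)) g
    (Rpower (2 * x) beta) (2 / x) x y (mkposreal _ hd)); simpl pos.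
  - apply Rlt_le, exp_pos.
  - apply Rlt_le, Rdiv_lt_0_compat; lra.
  - intros k u hu. apply is_derive_falling_power. apply Rabs_lt_between in hu. lra.
  - intros k u hu. apply Rabs_lt_between in hu.
    rewrite Rabs_mult, (Rabs_pos_eq (Rpower _ _)) by apply Rlt_le, exp_pos.
    unfold Rminus. rewrite Rpower_plus, Rpower_Ropp, Rpower_pow by lra.
    assert (h1 := falling_bound beta k hb).
    assert (h2 : Rpower u beta <= Rpower (2 * x) beta) by (apply Rle_Rpower_l; lra).
    assert (h3 : / u ^ k <= (2 / x) ^ k).
    { rewrite <- pow_inv. apply pow_incr. split; [apply Rlt_le, Rinv_0_lt_compat; lra|].
      replace (2 / x) with (/ (x / 2)) by (field; lra). apply Rinv_le_contravar; lra. }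
    apply Rle_trans with (INR (fact k) * (Rpower (2 * x) beta * (2 / x) ^ k)).
    + assert (h4 : 0 < Rpower u beta) by apply exp_pos.
      assert (h5 : 0 < / u ^ k) by (apply Rinv_0_lt_compat, pow_lt; lra).
      apply Rmult_le_compat; [apply Rabs_pos|apply Rmult_le_pos; lra|easy|].
      apply Rmult_le_compat; lra.
    + apply Req_le; ring.
  - exact hg.
Qed.

Lemma continuous_pow {T : UniformSpace} (s : T -> R) (p : T) (i : nat) :
  continuous s p -> continuous (fun q => s q ^ i) p.
Proof.
  intros hs. induction i as [|i IH]; simpl; [apply continuous_const|].
  now apply (continuous_mult (K := R_AbsRing) s (fun q => s q ^ i)).
Qed.

Lemma continuous_pderiv (f : R -> R -> R) (i j : nat) (M rho x y : R) (d : posreal) :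
  0 <= M -> 0 <= rho ->
  (forall u v, box x y d u v -> smooth_at (pderiv f) u v /\ cauchy_at (pderiv f) M rho u v) ->
  forall u v, box x y d u v -> continuous (fun z : R * R => pderiv f i j (fst z) (snd z)) (u, v).
Proof.
  intros hM hr h u v hb. destruct (box_open _ _ _ _ _ hb) as [e he].
  apply smooth_bounded_continuous with
    (C := M * INR (fact (S (i + j))) * rho ^ S (i + j)) (d := e).
  - apply cond_pos.
  - intros; now apply h, he.
  - intros p q hpq. destruct (h p q (he _ _ hpq)) as [_ hc]. split.
    + apply (hc (S i) j).
    + replace (S (i + j)) with (i + S j)%nat by lia. apply hc.
Qed.

(** Each derivative in z brings out a factor [sigma w] in [0, 1], so differentiation under the
    integral sign over an interval of length 1 keeps the constants [M] and [rho] that hold along the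
    segment from (0, y) to (x, y). *)
Lemma regular_integral (f : R -> R -> R) (sigma : R -> R) (x y : R) :
  (forall w, continuous sigma w) -> (forall w, 0 <= sigma w <= 1) ->
  (forall t, 0 <= t <= 1 -> regular f (t * x) y) ->
  regular (fun z v => RInt (fun w => f (z * sigma w) v) 0 1) x y.
Proof.
  intros hsc hs01 hf.
  destruct (regular_uniform f (fun t => t * x) (fun _ => y)) as [d [M [rho [hM [hr h]]]]].
  { intros t. apply (@ex_derive_continuous R_AbsRing R_NormedModule). now auto_derive. }
  { intros t. apply continuous_const. }
  { exact hf. }
  assert (hbox : forall z v s, 0 <= s <= 1 -> box x y d z v -> box (s * x) y d (z * s) v).
  { intros z v s hs [h1 h2]. split; [|easy].
    replace (z * s - s * x) with (s * (z - x)) by ring.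
    rewrite Rabs_mult, (Rabs_pos_eq s) by easy.
    assert (k := Rabs_pos (z - x)). apply Rle_lt_trans with (1 * Rabs (z - x)); [|lra].
    apply Rmult_le_compat_r; lra. }
  (* The space [T] is arbitrary because continuity is needed in w alone, for integrability, and
     jointly with z or v, for differentiation under the integral. *)
  assert (hcont : forall (T : UniformSpace) (a s v : T -> R) (p : T) i j,
    continuous a p -> continuous s p -> continuous v p -> 0 <= s p <= 1 ->
    box x y d (a p) (v p) ->
    continuous (fun q => s q ^ i * pderiv f i j (a q * s q) (v q)) p).
  { intros T a s v p i j ha hs hv hsp hb.
    apply (continuous_mult (K := R_AbsRing) (fun q => s q ^ i)); [now apply continuous_pow|].
    apply (continuous_comp_2 (fun q => a q * s q) v (pderiv f i j)); [|easy|].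
    - now apply (continuous_mult (K := R_AbsRing) a s).
    - apply continuous_pderiv with (M := M) (rho := rho) (x := s p * x) (y := y) (d := d); auto.
      intros u w; now apply h. }
  assert (hint : forall z v i j, box x y d z v ->
    ex_RInt (fun w => sigma w ^ i * pderiv f i j (z * sigma w) v) 0 1).
  { intros z v i j hb. apply (ex_RInt_continuous (V := R_CompleteNormedModule)).
    intros w _. apply (hcont R_UniformSpace (fun _ => z) sigma (fun _ => v) w);
      auto using continuous_const. }
  assert (hd1 : forall z v w i j, box x y d z v ->
    is_derive (fun u => sigma w ^ i * pderiv f i j (u * sigma w) v) z
              (sigma w ^ S i * pderiv f (S i) j (z * sigma w) v)).
  { intros z v w i j hb.
    replace (sigma w ^ S i * pderiv f (S i) j (z * sigma w) v)
      with (sigma w ^ i * (sigma w * pderiv f (S i) j (z * sigma w) v)) by (simpl; ring).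
    apply is_derive_scal.
    apply (is_derive_comp (fun u => pderiv f i j u v) (fun u => u * sigma w)).
    - apply (h (sigma w) (z * sigma w) v (hs01 w)); auto.
    - auto_derive; [easy|ring]. }
  assert (hd2 : forall z v w i j, box x y d z v ->
    is_derive (fun u => sigma w ^ i * pderiv f i j (z * sigma w) u) v
              (sigma w ^ i * pderiv f i (S j) (z * sigma w) v)).
  { intros z v w i j hb. apply is_derive_scal.
    apply (h (sigma w) (z * sigma w) v (hs01 w)); auto. }
  apply regular_of_family with (d := d) (M := M) (rho := rho)
    (G := fun i j z v => RInt (fun w => sigma w ^ i * pderiv f i j (z * sigma w) v) 0 1);
    try easy.
  { intros u v _. apply RInt_ext. intros w _. simpl. now rewrite Rmult_1_l. }
  intros z v hb. split.
  - intros i j. split.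
    + evar_last.
      * apply (is_derive_RInt_param
          (fun u w => sigma w ^ i * pderiv f i j (u * sigma w) v) 0 1 z).
        -- apply (box_locally_x x y d z v _ hb). intros u hu w _.
           eexists; now apply hd1.
        -- intros w _.
           apply continuity_2d_pt_ext_loc with
             (fun u w => sigma w ^ S i * pderiv f (S i) j (u * sigma w) v).
           ++ destruct (box_open _ _ _ _ _ hb) as [e he]. exists e. intros u w' hu _.
              symmetry. apply is_derive_unique, hd1, he. split; [easy|].
              rewrite Rminus_diag, Rabs_R0; apply cond_pos.
           ++ apply continuity_2d_pt_filterlim.
              apply (hcont _ fst (fun p : R * R => sigma (snd p)) (fun _ => v) (z, w) (S i) j).
              ** apply continuous_fst.
              ** apply (continuous_comp snd sigma); [apply continuous_snd|apply hsc].
              ** apply continuous_const.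
              ** apply hs01.
              ** easy.
        -- apply (box_locally_x x y d z v _ hb). intros u hu. now apply hint.
      * apply RInt_ext. intros w _. now apply is_derive_unique, hd1.
    + evar_last.
      * apply (is_derive_RInt_param
          (fun u w => sigma w ^ i * pderiv f i j (z * sigma w) u) 0 1 v).
        -- apply (box_locally_y x y d z v _ hb). intros u hu w _.
           eexists; now apply hd2.
        -- intros w _.
           apply continuity_2d_pt_ext_loc with
             (fun u w => sigma w ^ i * pderiv f i (S j) (z * sigma w) u).
           ++ destruct (box_open _ _ _ _ _ hb) as [e he]. exists e. intros u w' hu _.
              symmetry. apply is_derive_unique, hd2, he. split; [|easy].
              rewrite Rminus_diag, Rabs_R0; apply cond_pos.
           ++ apply continuity_2d_pt_filterlim.
              apply (hcont _ (fun _ => z) (fun p : R * R => sigma (snd p)) fst (v, w) i (S j)).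
              ** apply continuous_const.
              ** apply (continuous_comp snd sigma); [apply continuous_snd|apply hsc].
              ** apply continuous_fst.
              ** apply hs01.
              ** easy.
        -- apply (box_locally_y x y d z v _ hb). intros u hu. now apply hint.
      * apply RInt_ext. intros w _. now apply is_derive_unique, hd2.
  - intros i j.
    rewrite <- (Rmult_1_l (M * INR (fact (i + j)) * rho ^ (i + j))).
    replace 1 with (1 - 0) at 2 by ring.
    apply abs_RInt_le_const; [lra|now apply hint|].
    intros w _. rewrite Rabs_mult, <- RPow_abs, (Rabs_pos_eq (sigma w)) by apply hs01.
    rewrite <- (Rmult_1_l (M * INR (fact (i + j)) * rho ^ (i + j))).
    apply Rmult_le_compat; [apply pow_le, hs01|apply Rabs_pos| |].
    + rewrite <- (pow1 i). apply pow_incr, hs01.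
    + apply (h (sigma w) (z * sigma w) v (hs01 w)); auto.
Qed.

(** * Fractional derivatives *)

(* [Rpower 0 p] is 1, hence the case distinction. *)
Definition rpow (p w : R) : R := if Rle_dec w 0 then 0 else Rpower w p.

Lemma rpow_pos (p w : R) : 0 < w -> rpow p w = Rpower w p.
Proof. intros h. unfold rpow. destruct (Rle_dec w 0); [lra|easy]. Qed.

Lemma rpow_nonpos (p w : R) : w <= 0 -> rpow p w = 0.
Proof. intros h. unfold rpow. destruct (Rle_dec w 0); [easy|lra]. Qed.

Lemma rpow_ge_0 (p w : R) : 0 <= rpow p w.
Proof. unfold rpow. destruct (Rle_dec w 0); [lra|apply Rlt_le, exp_pos]. Qed.

Lemma rpow_le_1 (p w : R) : 0 < p -> w <= 1 -> rpow p w <= 1.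
Proof.
  intros hp hw. unfold rpow. destruct (Rle_dec w 0) as [h|h]; [lra|].
  replace 1 with (Rpower 1 p) by (unfold Rpower; rewrite ln_1, Rmult_0_r; apply exp_0).
  apply Rle_Rpower_l; lra.
Qed.

Lemma is_derive_Rpower (p w : R) : 0 < w ->
  is_derive (fun u => Rpower u p) w (p * Rpower w (p - 1)).
Proof. intros h. apply is_derive_Reals. now apply derivable_pt_lim_power. Qed.

Lemma continuous_rpow (p w : R) : 0 < p -> continuous (rpow p) w.
Proof.
  intros hp. destruct (Rtotal_order w 0) as [h|[h|h]].
  - apply continuous_ext_loc with (fun _ => 0); [|apply continuous_const].
    assert (hd : 0 < - w) by lra. exists (mkposreal _ hd). intros u hu.
    apply ball_Rabs in hu; simpl in hu. apply Rabs_lt_between in hu.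
    symmetry; apply rpow_nonpos; lra.
  - subst w. intros P [eps hP]. rewrite rpow_nonpos in hP by lra.
    (* For u > 0, u^p < eps amounts to u < eps^(1/p). *)
    exists (mkposreal (Rpower eps (/ p)) (exp_pos _)). intros u hu. apply hP.
    apply ball_Rabs in hu; simpl in hu. apply Rabs_ball.
    rewrite Rminus_0_r in hu |- *.
    rewrite (Rabs_pos_eq (rpow p u)) by apply rpow_ge_0.
    destruct (Rle_dec u 0) as [h|h].
    + rewrite rpow_nonpos by easy. apply cond_pos.
    + rewrite rpow_pos by lra. rewrite Rabs_pos_eq in hu by lra.
      replace (pos eps) with (Rpower (Rpower eps (/ p)) p).
      * apply Rlt_Rpower_l; [easy|lra].
      * rewrite Rpower_mult, Rinv_l, Rpower_1; [easy|apply cond_pos|lra].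
  - apply continuous_ext_loc with (fun u => Rpower u p).
    + exists (mkposreal _ h). intros u hu.
      apply ball_Rabs in hu; simpl in hu. apply Rabs_lt_between in hu.
      rewrite rpow_pos; [easy|lra].
    + apply (@ex_derive_continuous R_AbsRing R_NormedModule).
      eexists. now apply is_derive_Rpower.
Qed.

(* The substitution u = z * node p w with p = 1/beta turns the singular weight
   (z - u)^(beta - 1) du into the constant weight z^beta/beta dw.  The argument
   of [rpow] is min(1, w). *)
Definition node (p w : R) : R := 1 - rpow p ((1 + w - Rabs (1 - w)) / 2).

Lemma node_range (p w : R) : 0 < p -> 0 <= node p w <= 1.
Proof.
  intros hp. unfold node.
  assert (h1 := rpow_ge_0 p ((1 + w - Rabs (1 - w)) / 2)).
  assert (h2 : rpow p ((1 + w - Rabs (1 - w)) / 2) <= 1).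
  { apply rpow_le_1; [easy|]. unfold Rabs. destruct (Rcase_abs (1 - w)); lra. }
  lra.
Qed.

Lemma node_pos (p w : R) : 0 < w <= 1 -> node p w = 1 - Rpower w p.
Proof.
  intros h. unfold node. rewrite Rabs_pos_eq by lra.
  replace ((1 + w - (1 - w)) / 2) with w by field. now rewrite rpow_pos.
Qed.

Lemma continuous_node (p w : R) : 0 < p -> continuous (node p) w.
Proof.
  intros hp. unfold node.
  apply (continuous_minus (V := R_NormedModule) (fun _ => 1)); [apply continuous_const|].
  apply (continuous_comp (fun w => (1 + w - Rabs (1 - w)) / 2) (rpow p));
    [|now apply continuous_rpow].
  apply (continuous_mult (K := R_AbsRing) (fun w => 1 + w - Rabs (1 - w)));
    [|apply continuous_const].
  apply (continuous_minus (V := R_NormedModule) (fun w => 1 + w)).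
  - apply (@ex_derive_continuous R_AbsRing R_NormedModule). now auto_derive.
  - apply (continuous_comp (fun w => 1 - w) Rabs); [|apply continuous_Rabs].
    apply (@ex_derive_continuous R_AbsRing R_NormedModule). now auto_derive.
Qed.

(** On [0, b] with b < z the substitution is smooth and gives the value [V b]; the improper integral
    is the limit of [V] at z, where [V] is continuous. *)
Lemma is_RInt_gen_frac_kernel (h : R -> R) (z e : R) : 0 < z -> e < 1 ->
  (forall u, 0 <= u <= z -> continuous h u) ->
  is_RInt_gen (fun u => h u / Rpower (z - u) e) (at_point 0) (at_left z)
    (Rpower z (1 - e) / (1 - e) * RInt (fun w => h (z * node (/ (1 - e)) w)) 0 1).
Proof.
  intros hz he hh. set (beta := 1 - e). set (p := / beta).
  assert (hb : 0 < beta) by (unfold beta; lra).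
  assert (hp : 0 < p) by now apply Rinv_0_lt_compat.
  set (F := fun w => h (z * node p w)).
  assert (hF : forall w, continuous F w).
  { intros w. apply (continuous_comp (fun w => z * node p w) h).
    - apply (continuous_mult (K := R_AbsRing) (fun _ => z)); [apply continuous_const|].
      now apply continuous_node.
    - apply hh. assert (k := node_range p w hp). nra. }
  assert (hexF : forall a b, ex_RInt F a b).
  { intros a b. apply (ex_RInt_continuous (V := R_CompleteNormedModule)). auto. }
  (* The inverse w = (1 - u/z)^beta of the substitution decreases from 1 towards 0, whence the minus
     signs below. [V] is written with [rpow], which is 0 at 0, so that it is continuous at b = z. *)
  set (g := fun u => Rpower (1 - u / z) beta).
  set (V := fun b => Rpower z beta / beta * RInt F (rpow beta (1 - b / z)) 1).
  assert (hV : forall b, 0 < b < z -> is_RInt (fun u => h u / Rpower (z - u) e) 0 b (V b)).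
  { intros b hbz.
    assert (hu : forall u, 0 <= u <= b -> 0 < 1 - u / z <= 1).
    { intros u hu. split.
      - apply Rlt_0_minus. apply Rmult_lt_reg_r with z; [easy|].
        unfold Rdiv. rewrite Rmult_assoc, Rinv_l by lra. lra.
      - assert (0 <= u / z) by (apply Rdiv_le_0_compat; lra). lra. }
    assert (hc := is_RInt_comp (V := R_CompleteNormedModule) F g
      (fun u => - / z * (beta * Rpower (1 - u / z) (beta - 1))) 0 b).
    apply is_RInt_ext with
      (fun u => scal (- (Rpower z beta / beta))
        (scal (- / z * (beta * Rpower (1 - u / z) (beta - 1))) (F (g u)))).
    - rewrite Rmin_left, Rmax_right by lra. intros u hu0.
      assert (hu1 := hu u ltac:(lra)).
      assert (e1 : F (g u) = h u).
      { unfold F, g. rewrite node_pos.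
        - unfold p. rewrite Rpower_mult, Rinv_r, Rpower_1 by lra.
          f_equal. field. lra.
        - split; [apply exp_pos|].
          rewrite <- (rpow_pos beta) by easy. apply rpow_le_1; easy. }
      rewrite e1. unfold scal; simpl; unfold mult; simpl.
      assert (e2 : Rpower (z - u) e = / (Rpower (1 - u / z) (beta - 1) * (Rpower z beta / z))).
      { replace (z - u) with ((1 - u / z) * z) by (field; lra).
        replace e with (- (beta - 1)) by (unfold beta; ring).
        rewrite Rpower_Ropp. f_equal.
        rewrite <- Rpower_mult_distr by easy. f_equal.
        unfold Rminus. rewrite Rpower_plus, Rpower_Ropp, Rpower_1 by easy. reflexivity. }
      rewrite e2. unfold Rdiv. rewrite Rinv_inv. field. lra.
    - replace (V b) with (scal (- (Rpower z beta / beta)) (RInt F (g 0) (g b))).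
      + apply (is_RInt_scal (V := R_NormedModule)). apply hc.
        * intros u _. apply hF.
        * rewrite Rmin_left, Rmax_right by lra. intros u hu0.
          assert (hu1 := hu u ltac:(lra)). split.
          -- unfold g. apply (is_derive_comp (fun s => Rpower s beta) (fun u => 1 - u / z)).
             ++ now apply is_derive_Rpower.
             ++ auto_derive; [lra|]. field. lra.
          -- apply (continuous_mult (K := R_AbsRing) (fun _ => - / z));
               [apply continuous_const|].
             apply (continuous_mult (K := R_AbsRing) (fun _ => beta));
               [apply continuous_const|].
             apply (@ex_derive_continuous R_AbsRing R_NormedModule).
             eexists. apply (is_derive_comp (fun s => Rpower s (beta - 1)) (fun u => 1 - u / z)).
             ++ now apply is_derive_Rpower.
             ++ auto_derive; [lra|reflexivity].
      + unfold V, scal; simpl; unfold mult; simpl.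
        rewrite (rpow_pos beta) by (apply hu; lra). fold (g b).
        replace (g 0) with 1.
        2: { unfold g. replace (1 - 0 / z) with 1 by (field; lra).
             unfold Rpower. now rewrite ln_1, Rmult_0_r, exp_0. }
        rewrite <- (opp_RInt_swap F 1 (g b)) by apply hexF.
        unfold opp; simpl. ring. }
  assert (hVc : continuous V z).
  { apply (continuous_mult (K := R_AbsRing) (fun _ => Rpower z beta / beta));
      [apply continuous_const|].
    apply (continuous_comp (fun b => rpow beta (1 - b / z)) (fun c => RInt F c 1)).
    - apply (continuous_comp (fun b => 1 - b / z) (rpow beta)); [|now apply continuous_rpow].
      apply (@ex_derive_continuous R_AbsRing R_NormedModule). auto_derive. lra.
    - apply (@ex_derive_continuous R_AbsRing R_NormedModule).
      eexists. apply (is_derive_RInt' F _ _ 1).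
      + exists (mkposreal 1 Rlt_0_1). intros u _. apply (RInt_correct F), hexF.
      + apply hF. }
  assert (hVz : V z = Rpower z beta / beta * RInt F 0 1).
  { unfold V. rewrite rpow_nonpos; [easy|]. apply Req_le. field. lra. }
  rewrite <- hVz. intros P hP. specialize (hVc P hP).
  apply (Filter_prod _ _ _ (fun a => a = 0) (fun b => 0 < b < z /\ P (V b))).
  - reflexivity.
  - unfold at_left, within.
    assert (hz0 : locally z (fun b => 0 < b)).
    { exists (mkposreal z hz). intros b hb0. apply ball_Rabs in hb0; simpl in hb0.
      apply Rabs_lt_between in hb0. lra. }
    generalize (filter_and _ _ hz0 hVc). apply filter_imp. tauto.
  - intros a b ha [hb0 hb1]. subst a. exists (V b). split; [|easy]. now apply hV.
Qed.

Lemma regular_ex_derive (g : R -> R -> R) (x y : R) :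
  regular g x y -> ex_derive (fun u => g u y) x.
Proof.
  intros [d [M [rho [_ [_ h]]]]].
  destruct (h x y (box_center _ _ _ (cond_pos d))) as [hs _].
  destruct (hs 0%nat 0%nat) as [h1 _]. eexists. exact h1.
Qed.

Lemma regular_segment (g : R -> R -> R) (x y : R) :
  (forall t, 0 <= t <= 1 -> regular g (t * x) y) ->
  exists d : posreal, forall t u v, 0 <= t <= 1 -> box (t * x) y d u v -> regular g u v.
Proof.
  intros hf.
  destruct (regular_uniform g (fun t => t * x) (fun _ => y)) as [d [M [rho [hM [hr h]]]]].
  { intros t. apply (@ex_derive_continuous R_AbsRing R_NormedModule). now auto_derive. }
  { intros t. apply continuous_const. }
  { exact hf. }
  exists d. intros t u v ht hb.
  destruct (box_open _ _ _ _ _ hb) as [e he].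
  exists e, M, rho. split; [easy|split; [easy|]]. intros p q hpq. apply (h t); auto.
Qed.

(** Near x the improper integral is z^(1-e)/(1-e) times a proper integral over dilated points;
    [regular_mult_power] and [regular_integral] handle the two factors. *)
Lemma regular_frac_integral (g : R -> R -> R) (e x y : R) : 0 <= e < 1 -> 0 < x ->
  (forall t, 0 <= t <= 1 -> regular g (t * x) y) ->
  regular (fun z v => RInt_gen (fun u => g u v / Rpower (z - u) e) (at_point 0) (at_left z)) x y.
Proof.
  intros he hx hg.
  assert (hp : 0 < / (1 - e)) by (apply Rinv_0_lt_compat; lra).
  destruct (regular_segment g x y hg) as [d hd].
  assert (hm : 0 < Rmin d x) by (apply Rmin_pos; [apply cond_pos|easy]).
  apply regular_ext with (d := mkposreal _ hm)
    (f := fun z v => / (1 - e) * (Rpower z (1 - e)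
                      * RInt (fun w => g (z * node (/ (1 - e)) w) v) 0 1)).
  - simpl. intros z v hb. symmetry.
    assert (hb1 : box x y d z v) by (eapply box_le; [apply Rmin_l|exact hb]).
    assert (hb2 : box x y x z v) by (eapply box_le; [apply Rmin_r|exact hb]).
    assert (hz : 0 < z) by (destruct hb2 as [h _]; apply Rabs_lt_between in h; lra).
    transitivity (Rpower z (1 - e) / (1 - e) * RInt (fun w => g (z * node (/ (1 - e)) w) v) 0 1);
      [|unfold Rdiv; ring].
    apply is_RInt_gen_unique; try apply _.
    apply (is_RInt_gen_frac_kernel (fun u => g u v)); [easy|easy|].
    intros u hu. apply (@ex_derive_continuous R_AbsRing R_NormedModule).
    (* A point u of [0, z] is the fraction u/z of z, and so lies within the uniform radius of the
       same fraction of x. *)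
    apply regular_ex_derive. apply (hd (u / z)).
    + split; [apply Rdiv_le_0_compat; lra|].
      apply Rmult_le_reg_r with z; [easy|]. unfold Rdiv. rewrite Rmult_assoc, Rinv_l; lra.
    + destruct hb1 as [h1 h2]. split; [|easy].
      replace (u - u / z * x) with (u / z * (z - x)) by (field; lra).
      assert (hs : 0 <= u / z <= 1).
      { split; [apply Rdiv_le_0_compat; lra|].
        apply Rmult_le_reg_r with z; [easy|]. unfold Rdiv. rewrite Rmult_assoc, Rinv_l; lra. }
      rewrite Rabs_mult, (Rabs_pos_eq (u / z)) by easy.
      assert (k := Rabs_pos (z - x)). apply Rle_lt_trans with (1 * Rabs (z - x)); [|lra].
      apply Rmult_le_compat_r; lra.
  - apply (regular_scal _ (fun z v => Rpower z (1 - e)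
      * RInt (fun w => g (z * node (/ (1 - e)) w) v) 0 1)).
    apply regular_mult_power; [lra|easy|].
    apply regular_integral; try easy.
    + intros w. now apply continuous_node.
    + intros w. now apply node_range.
Qed.

Lemma up_nat_bounds (alpha : R) : 0 < alpha ->
  alpha < INR (Z.to_nat (up alpha)) <= alpha + 1.
Proof.
  intros h. destruct (archimed alpha) as [h1 h2].
  rewrite INR_IZR_INZ, Z2Nat.id by (apply le_IZR; lra). lra.
Qed.

(** The two definitions perform the same operations in opposite orders, n derivatives and an
    integral with exponent alpha - n + 1 in [0, 1), and each operation preserves regularity. *)
Lemma regular_Dfrac_x (kd : frac_kind) (alpha : R) (f : R -> R -> R) (x y : R) :
  0 < alpha -> 0 < x -> (forall t, 0 <= t <= 1 -> regular f (t * x) y) ->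
  regular (Dfrac_x kd alpha f) x y.
Proof.
  intros ha hx hf.
  assert (hn := up_nat_bounds alpha ha). set (n := Z.to_nat (up alpha)) in *.
  assert (hfx : regular f x y).
  { rewrite <- (Rmult_1_l x). apply hf. lra. }
  set (one := mkposreal 1 Rlt_0_1).
  destruct (Req_EM_T alpha (INR (pred n))) as [heq|hne].
  - apply regular_ext with (f := pderiv f (pred n) 0) (d := one).
    + intros u v _. unfold Dfrac_x, frac_deriv. fold n.
      now destruct (Req_EM_T alpha (INR (pred n))).
    + now apply regular_pderiv.
  - destruct kd.
    + apply regular_ext with (d := one)
        (f := fun u v => / Gamma (INR n - alpha) *
           pderiv (fun z v => RInt_gen (fun s => f s v / Rpower (z - s) (alpha - INR n + 1))
                                       (at_point 0) (at_left z)) n 0 u v).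
      * intros u v _. unfold Dfrac_x, frac_deriv. fold n.
        now destruct (Req_EM_T alpha (INR (pred n))).
      * apply regular_scal, regular_pderiv, regular_frac_integral; try easy. lra.
    + apply regular_ext with (d := one)
        (f := fun u v => / Gamma (INR n - alpha) *
           RInt_gen (fun s => pderiv f n 0 s v / Rpower (u - s) (alpha - INR n + 1))
                    (at_point 0) (at_left u)).
      * intros u v _. unfold Dfrac_x, frac_deriv. fold n.
        now destruct (Req_EM_T alpha (INR (pred n))).
      * apply (regular_scal _ (fun u v =>
           RInt_gen (fun s => pderiv f n 0 s v / Rpower (u - s) (alpha - INR n + 1))
                    (at_point 0) (at_left u))).
        apply regular_frac_integral; try easy; [lra|].
        intros t ht. now apply regular_pderiv, hf.
Qed.

(** [RInt_gen] is a choice from the predicate [is_RInt_gen]. The two predicates are equal by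
    extensionality, so the values agree whether or not the integrals converge. *)
Lemma RInt_gen_at_left_ext (f g : R -> R) (z : R) : 0 < z ->
  (forall u, 0 < u < z -> f u = g u) ->
  RInt_gen f (at_point 0) (at_left z) = RInt_gen g (at_point 0) (at_left z).
Proof.
  intros hz he. unfold RInt_gen. f_equal.
  assert (H : forall f g : R -> R, (forall u, 0 < u < z -> f u = g u) ->
    filter_prod (at_point 0) (at_left z)
      (fun ab => forall u, Rmin (fst ab) (snd ab) < u < Rmax (fst ab) (snd ab) -> f u = g u)).
  { intros f0 g0 he0. apply (Filter_prod _ _ _ (fun a => a = 0) (fun b => 0 < b < z)).
    - reflexivity.
    - exists (mkposreal z hz). intros b hb hlt. apply ball_Rabs in hb; simpl in hb.
      apply Rabs_lt_between in hb. lra.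
    - intros a b -> hb u. simpl. rewrite Rmin_left, Rmax_right by lra. intros hu.
      apply he0. lra. }
  apply functional_extensionality; intros l. apply propositional_extensionality.
  split; apply is_RInt_gen_ext; apply H; auto. intros; symmetry; auto.
Qed.

(** Neighbourhoods of the path are required because the Caputo integrand contains derivatives along
    it, and the Riemann-Liouville integral is differentiated in its upper limit at x. *)
Lemma frac_deriv_ext (kd : frac_kind) (alpha : R) (h1 h2 : R -> R) (x : R) : 0 < x ->
  (forall s, 0 <= s <= 1 -> locally (s * x) (fun u => h1 u = h2 u)) ->
  frac_deriv kd alpha h1 x = frac_deriv kd alpha h2 x.
Proof.
  intros hx he.
  assert (hu : forall u, 0 <= u <= x -> locally u (fun u => h1 u = h2 u)).
  { intros u hu. replace u with (u / x * x) by (field; lra). apply he.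
    split; [apply Rdiv_le_0_compat; lra|].
    apply Rmult_le_reg_r with x; [easy|]. unfold Rdiv. rewrite Rmult_assoc, Rinv_l; lra. }
  unfold frac_deriv. set (n := Z.to_nat (up alpha)).
  destruct (Req_EM_T alpha (INR (pred n))) as [_|_].
  - apply Derive_n_ext_loc. apply hu. lra.
  - destruct kd.
    + unfold RL_deriv. f_equal. apply Derive_n_ext_loc.
      destruct (hu x ltac:(lra)) as [d hd].
      assert (hm : 0 < Rmin d x) by (apply Rmin_pos; [apply cond_pos|easy]).
      exists (mkposreal _ hm). intros z hz. apply ball_Rabs in hz; simpl in hz.
      assert (l1 := Rmin_l d x). assert (l2 := Rmin_r d x). apply Rabs_lt_between in hz.
      apply RInt_gen_at_left_ext; [lra|]. intros u hu0. f_equal.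
      (* The upper limit z may exceed x; a u beyond x lies between x and z, hence in the
         neighbourhood of x. *)
      destruct (Rle_dec u x) as [hle|hgt].
      * apply (locally_singleton u (fun u => h1 u = h2 u)). apply hu. lra.
      * apply hd. apply Rabs_ball. apply Rabs_lt_between. lra.
    + unfold Caputo_deriv. f_equal.
      apply RInt_gen_at_left_ext; [easy|]. intros u hu0. f_equal.
      apply Derive_n_ext_loc, hu. lra.
Qed.

(** * The transformation law *)

Definition regular_dom (f : R -> R -> R) (p : R * R) : Prop := regular f (fst p) (snd p).

(** Rotating (X, Y) and (X0, Y) by the same angle keeps them within |X - X0| in each coordinate, so
    the uniform radius along one arc serves the nearby arcs. *)
Lemma regular_near_arc (f : R -> R -> R) (phi X0 Y : R) :
  (forall t, 0 <= t <= 1 -> regular f (rot_x (t * phi) X0 Y) (rot_y (t * phi) X0 Y)) ->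
  locally X0 (fun X => forall t, 0 <= t <= 1 ->
    regular f (rot_x (t * phi) X Y) (rot_y (t * phi) X Y)).
Proof.
  intros hf.
  destruct (regular_uniform f _ _ (continuous_rot_x phi X0 Y) (continuous_rot_y phi X0 Y) hf)
    as [d [M [rho [hM [hr h]]]]].
  exists d. intros X hX t ht. apply ball_Rabs in hX.
  assert (hb : box (rot_x (t * phi) X0 Y) (rot_y (t * phi) X0 Y) d
                   (rot_x (t * phi) X Y) (rot_y (t * phi) X Y)).
  { assert (h0 := Rabs_pos (X - X0)). split; unfold rot_x, rot_y.
    - replace (_ - _) with (cos (t * phi) * (X - X0)) by ring. rewrite Rabs_mult.
      assert (k := Rabs_cos_le (t * phi)).
      apply Rle_lt_trans with (1 * Rabs (X - X0)); [now apply Rmult_le_compat_r|lra].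
    - replace (_ - _) with (- sin (t * phi) * (X - X0)) by ring.
      rewrite Rabs_mult, Rabs_Ropp.
      assert (k := Rabs_sin_le (t * phi)).
      apply Rle_lt_trans with (1 * Rabs (X - X0)); [now apply Rmult_le_compat_r|lra]. }
  destruct (box_open _ _ _ _ _ hb) as [e he].
  exists e, M, rho. split; [easy|split; [easy|]]. intros u v huv. apply (h t); auto.
Qed.

(** The common value is [Dfrac_x kd alpha f] at the rotated point. The first half of
    [rotation_domain_x] makes D^alpha f regular on the arc from (x, y), the second makes [f] regular
    on the arcs that end on the path of integration. *)
Lemma Dfrac_x_rotation (kd : frac_kind) (alpha : R) (f F : R -> R -> R) (phi x y : R) :
  0 < alpha ->
  (forall X Y, F X Y = exp_L phi f (rot_x (- phi) X Y) (rot_y (- phi) X Y)) ->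
  (forall t, 0 <= t <= 1 -> 0 < rot_x (t * phi) x y) ->
  rotation_domain_x (regular_dom f) phi x y ->
  transform_converges_x phi f (rot_x phi x y) (rot_y phi x y) ->
  ex_exp_L phi (Dfrac_x kd alpha f) x y ->
  Dfrac_x kd alpha F (rot_x phi x y) (rot_y phi x y) = exp_L phi (Dfrac_x kd alpha f) x y.
Proof.
  intros ha hF hpos hdom hconv hex.
  rewrite (exp_L_eq_rot (Dfrac_x kd alpha f)); [|intros t ht|easy].
  - apply frac_deriv_ext.
    + rewrite <- (Rmult_1_l phi) at 1. apply hpos. lra.
    + intros s hs.
      assert (harc := regular_near_arc f (- phi) (s * rot_x phi x y) (rot_y phi x y)).
      assert (h1 : locally (s * rot_x phi x y) (fun X => forall t, 0 <= t <= 1 ->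
        regular f (rot_x (t * - phi) X (rot_y phi x y)) (rot_y (t * - phi) X (rot_y phi x y)))).
      { apply harc. intros t ht. replace (t * - phi) with (- (t * phi)) by ring.
        exact (proj2 (hdom s t hs ht)). }
      generalize (filter_and _ _ h1 (hconv s hs)). apply filter_imp.
      intros X [hX1 hX2]. rewrite hF.
      rewrite exp_L_eq_rot.
      * now rewrite rot_x_neg_rot, rot_y_neg_rot.
      (* The arc that ends at (X, Y) is the backward arc from (X, Y) run in reverse, with parameter
         1 - t. *)
      * intros t ht. rewrite rot_x_add, rot_y_add.
        replace (t * phi + - phi) with ((1 - t) * - phi) by ring.
        apply hX1. lra.
      * exact hX2.
  - apply regular_Dfrac_x; [easy|now apply hpos|].
    intros s hs. exact (proj1 (hdom s t hs ht)).
Qed.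

(** For phi >= 0 the cosine is positive and the sine nonnegative at t phi. For phi < 0 both cosine
    and sine are at least as large at t phi as at phi, so positivity at phi suffices. *)
Lemma rot_x_pos_between (phi x y t : R) : - (PI / 2) < phi < PI / 2 -> 0 < x -> 0 < y ->
  0 < rot_x phi x y -> 0 <= t <= 1 -> 0 < rot_x (t * phi) x y.
Proof.
  intros hphi hx hy hr ht. unfold rot_x in *. assert (hpi := PI_RGT_0).
  destruct (Rle_dec 0 phi) as [h0|h0].
  - assert (h1 : 0 <= t * phi) by nra. assert (h2 : t * phi <= phi) by nra.
    assert (hc : 0 < cos (t * phi)) by (apply cos_gt_0; lra).
    assert (hs : 0 <= sin (t * phi)) by (apply sin_ge_0; lra).
    nra.
  - set (a := - phi) in *.
    replace phi with (- a) in hr by (unfold a; ring).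
    replace (t * phi) with (- (t * a)) by (unfold a; ring).
    rewrite cos_neg, sin_neg in *.
    assert (ha : 0 < a < PI / 2) by (unfold a; lra).
    assert (h1 : 0 <= t * a) by nra. assert (h2 : t * a <= a) by nra.
    assert (hc : cos a <= cos (t * a)) by (apply cos_decr_1; lra).
    assert (hs : sin (t * a) <= sin a) by (apply sin_incr_1; lra).
    nra.
Qed.

(** For small phi every rotated point stays in the neighbourhood of the segment where the estimates
    are uniform, and there the terms of both exponential series are dominated by geometric ones. *)
Lemma Dfrac_x_small_rotation (kd : frac_kind) (alpha : R) (f : R -> R -> R)
    (f' : R -> R -> R -> R) (x y : R) :
  0 < alpha -> 0 < x -> 0 < y ->
  (forall phi X Y, f' phi X Y = exp_L phi f (rot_x (- phi) X Y) (rot_y (- phi) X Y)) ->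
  (forall s, 0 <= s <= 1 -> regular f (s * x) y) ->
  exists (delta : posreal) (C : R), forall phi, Rabs phi < delta ->
    transform_converges_x phi f (rot_x phi x y) (rot_y phi x y) /\
    ex_exp_L phi (Dfrac_x kd alpha f) x y /\
    Dfrac_x kd alpha (f' phi) (rot_x phi x y) (rot_y phi x y)
      = exp_L phi (Dfrac_x kd alpha f) x y /\
    Rabs (Dfrac_x kd alpha (f' phi) (rot_x phi x y) (rot_y phi x y)
          - (Dfrac_x kd alpha f x y + phi * L_op (Dfrac_x kd alpha f) x y)) <= C * phi ^ 2.
Proof.
  intros ha hx hy hf' hseg.
  destruct (regular_uniform f (fun t => t * x) (fun _ => y)) as [d [M [rho [hM [hrho h]]]]].
  { intros t. apply (@ex_derive_continuous R_AbsRing R_NormedModule). now auto_derive. }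
  { intros t. apply continuous_const. }
  { exact hseg. }
  assert (hreg : forall s u v, 0 <= s <= 1 -> box (s * x) y d u v -> regular f u v).
  { intros s u v hs hb. destruct (box_open _ _ _ _ _ hb) as [e he].
    exists e, M, rho. split; [easy|split; [easy|]]. intros p q hpq. apply (h s); auto. }
  set (D := Dfrac_x kd alpha f).
  destruct (regular_Dfrac_x kd alpha f x y ha hx hseg) as [d2 [M2 [rho2 [hM2 [hrho2 h2]]]]].
  fold D in h2.
  set (T := x + y). assert (hT : 0 < T) by (unfold T; lra).
  (* [K1] is the growth rate of the series for [f], at points up to [d] away from the segment; [K2]
     is that of the series for D^alpha f, at (x, y) itself. *)
  set (K1 := 2 * (T + d) * rho + 1). set (K2 := 2 * T * rho2 + 1).
  assert (hd := cond_pos d).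
  assert (hK1 : 1 <= K1).
  { unfold K1. assert (0 <= 2 * (T + d) * rho) by (apply Rmult_le_pos; lra). lra. }
  assert (hK2 : 1 <= K2).
  { unfold K2. assert (0 <= 2 * T * rho2) by (apply Rmult_le_pos; lra). lra. }
  assert (hb2 : forall n, Rabs (Nat.iter n L_op D x y) <= M2 * INR (fact n) * K2 ^ n).
  { apply iter_L_op_bound with d2; try easy.
    - rewrite Rabs_pos_eq; unfold T; lra.
    - rewrite Rabs_pos_eq; unfold T; lra.
    - intros u v hb. now apply h2.
    - apply h2, box_center, cond_pos. }
  assert (p1 : 0 < T / x) by now apply Rdiv_lt_0_compat.
  assert (p3 : 0 < 6 * T / d) by (apply Rdiv_lt_0_compat; lra).
  (* Each summand secures one inequality for [a] < 1/[Sg]: the first coordinate stays positive (a T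
     < x), rotated points stay close (3 a T < d/2), the series for [f] converges (a K1 < 1), and the
     remainder bound applies (a K2 <= 1/2). *)
  set (Sg := T / x + 6 * T / d + K1 + 2 * K2).
  assert (hS : 0 < / Sg) by (apply Rinv_0_lt_compat; unfold Sg; lra).
  exists (mkposreal _ hS), (2 * M2 * K2 ^ 2). intros phi hphi; simpl in hphi.
  set (a := Rabs phi) in *. assert (ha0 : 0 <= a) by apply Rabs_pos.
  assert (haS : forall q, 0 <= q <= Sg -> a * q < 1).
  { intros q hq. apply Rle_lt_trans with (a * Sg); [now apply Rmult_le_compat_l|].
    rewrite <- (Rinv_l Sg) by (unfold Sg; lra). apply Rmult_lt_compat_r; [unfold Sg; lra|easy]. }
  assert (a1 : a * T < x).
  { assert (k := haS (T / x) ltac:(unfold Sg; lra)).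
    replace (a * T) with (a * (T / x) * x) by (field; lra). nra. }
  assert (a2 : 3 * (a * T) < d / 2).
  { assert (k := haS (6 * T / d) ltac:(unfold Sg; lra)).
    replace (3 * (a * T)) with (a * (6 * T / d) * (d / 2)) by (field; lra). nra. }
  assert (a3 : a * K1 < 1) by (apply haS; unfold Sg; lra).
  assert (a4 : a * K2 <= 1 / 2).
  { assert (k := haS (2 * K2) ltac:(unfold Sg; lra)). lra. }
  assert (haT : 0 <= a * T) by (apply Rmult_le_pos; lra).
  assert (hxT : Rabs x + Rabs y = T) by (rewrite !Rabs_pos_eq by lra; easy).
  assert (ht : forall t, 0 <= t <= 1 -> Rabs (t * phi) <= a).
  { intros t h0. rewrite Rabs_mult, (Rabs_pos_eq t) by easy. fold a. nra. }
  assert (rx : forall t, 0 <= t <= 1 -> Rabs (rot_x (t * phi) x y - x) <= a * T).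
  { intros t h0. eapply Rle_trans; [apply Rabs_rot_x_sub_le|]. rewrite hxT.
    apply Rmult_le_compat_r; [lra|auto]. }
  assert (ry : forall t, 0 <= t <= 1 -> Rabs (rot_y (t * phi) x y - y) <= a * T).
  { intros t h0. eapply Rle_trans; [apply Rabs_rot_y_sub_le|]. rewrite hxT.
    apply Rmult_le_compat_r; [lra|auto]. }
  assert (box1 : forall s t, 0 <= s <= 1 -> 0 <= t <= 1 ->
    Rabs (s * rot_x (t * phi) x y - s * x) <= a * T).
  { intros s t hs h0. rewrite <- Rmult_minus_distr_l, Rabs_mult, (Rabs_pos_eq s) by easy.
    assert (k := rx t h0). assert (k' := Rabs_pos (rot_x (t * phi) x y - x)). nra. }
  set (x' := rot_x phi x y). set (y' := rot_y phi x y).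
  assert (ex' : x' = rot_x (1 * phi) x y) by now rewrite Rmult_1_l.
  assert (ey' : y' = rot_y (1 * phi) x y) by now rewrite Rmult_1_l.
  assert (hx' : Rabs x' <= T) by (rewrite <- hxT; apply Rabs_rot_x_le).
  assert (hy' : Rabs y' <= T) by (rewrite <- hxT; apply Rabs_rot_y_le).
  assert (hsx' : forall s, 0 <= s <= 1 -> Rabs (s * x') + Rabs y' <= 2 * T).
  { intros s hs. rewrite Rabs_mult, (Rabs_pos_eq s) by easy.
    assert (k := Rabs_pos x'). nra. }
  (* Of the 3 a T, rotating back a point of size at most 2T accounts for 2 a T, and replacing x by
     x', or y by y', for the rest. *)
  assert (box2 : forall s t, 0 <= s <= 1 -> 0 <= t <= 1 ->
    Rabs (rot_x (- (t * phi)) (s * x') y' - s * x) <= 3 * (a * T) /\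
    Rabs (rot_y (- (t * phi)) (s * x') y' - y) <= 3 * (a * T)).
  { intros s t hs h0.
    assert (k := hsx' s hs). assert (kt := ht t h0).
    assert (h01 : 0 <= 1 <= 1) by lra.
    assert (k1 := box1 s 1 hs h01). rewrite <- ex' in k1.
    assert (k2 := ry 1 h01). rewrite <- ey' in k2.
    assert (kb : Rabs (- (t * phi)) * (Rabs (s * x') + Rabs y') <= a * (2 * T)).
    { rewrite Rabs_Ropp. apply Rmult_le_compat; try easy; [apply Rabs_pos|].
      apply Rplus_le_le_0_compat; apply Rabs_pos. }
    split.
    - replace (rot_x (- (t * phi)) (s * x') y' - s * x)
        with ((rot_x (- (t * phi)) (s * x') y' - s * x') + (s * x' - s * x)) by ring.
      eapply Rle_trans; [apply Rabs_triang|].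
      assert (k3 := Rabs_rot_x_sub_le (- (t * phi)) (s * x') y'). lra.
    - replace (rot_y (- (t * phi)) (s * x') y' - y)
        with ((rot_y (- (t * phi)) (s * x') y' - y') + (y' - y)) by ring.
      eapply Rle_trans; [apply Rabs_triang|].
      assert (k3 := Rabs_rot_y_sub_le (- (t * phi)) (s * x') y'). lra. }
  assert (hconv : transform_converges_x phi f x' y').
  { intros s hs.
    assert (hd2 : 0 < d / 2) by lra.
    (* The displacement of the path uses less than d/2, which leaves d/2 for the neighbourhood of
       its points. *)
    exists (mkposreal _ hd2). intros X hX. apply ball_Rabs in hX; simpl in hX.
    unfold transform_converges.
    destruct (box2 s 1 hs ltac:(lra)) as [k1 k2]. rewrite Rmult_1_l in k1, k2.
    set (u := rot_x (- phi) X y'). set (v := rot_y (- phi) X y').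
    assert (hb : box (s * x) y d u v).
    { assert (k0 := Rabs_pos (X - s * x')). split.
      - replace (u - s * x)
          with (cos (- phi) * (X - s * x') + (rot_x (- phi) (s * x') y' - s * x))
          by (unfold u, rot_x; ring).
        eapply Rle_lt_trans; [apply Rabs_triang|]. rewrite Rabs_mult.
        assert (k := Rabs_cos_le (- phi)). nra.
      - replace (v - y)
          with (- sin (- phi) * (X - s * x') + (rot_y (- phi) (s * x') y' - y))
          by (unfold v, rot_y; ring).
        eapply Rle_lt_trans; [apply Rabs_triang|]. rewrite Rabs_mult, Rabs_Ropp.
        assert (k := Rabs_sin_le (- phi)). nra. }
    destruct (box_open _ _ _ _ _ hb) as [e he].
    apply ex_exp_L_small with M K1; try easy; [lra|].
    apply iter_L_op_bound with e; try easy.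
    - replace u with ((u - s * x) + s * x) by ring.
      eapply Rle_trans; [apply Rabs_triang|]. destruct hb as [hb1 _].
      rewrite (Rabs_pos_eq (s * x)) by (apply Rmult_le_pos; lra). unfold T. nra.
    - replace v with ((v - y) + y) by ring.
      eapply Rle_trans; [apply Rabs_triang|]. destruct hb as [_ hb1].
      rewrite (Rabs_pos_eq y) by lra. unfold T. lra.
    - intros p q hpq. apply (h s); auto.
    - now apply (h s). }
  assert (hex : ex_exp_L phi D x y) by (apply ex_exp_L_small with M2 K2; try easy; fold a; lra).
  assert (heq : Dfrac_x kd alpha (f' phi) x' y' = exp_L phi D x y).
  { apply Dfrac_x_rotation; auto.
    - intros t h0. assert (k := rx t h0). apply Rabs_le_between in k. lra.
    - intros s t hs h0. split.
      + apply (hreg s); [easy|]. simpl. split.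
        * assert (k := box1 s t hs h0). lra.
        * assert (k := ry t h0). lra.
      + destruct (box2 s t hs h0) as [k1 k2].
        apply (hreg s); [easy|]. simpl. fold x' y'. split; lra. }
  split; [exact hconv|split; [exact hex|split; [exact heq|]]].
  rewrite heq. apply exp_L_first_order; try easy; fold a; lra.
Qed.

(** * The second variable, by reflection in the diagonal *)

Definition swap (g : R -> R -> R) (x y : R) : R := g y x.

(** [pderiv] differentiates in a fixed order, which the reflection reverses; [regular_of_family]
    accepts the family in the other order. *)
Lemma regular_swap (g : R -> R -> R) (x y : R) : regular g x y -> regular (swap g) y x.
Proof.
  intros [d [M [rho [hM [hr h]]]]].
  apply regular_of_family with (d := d) (M := M) (rho := rho)
    (G := fun i j => swap (pderiv g j i)); try easy.
  intros u v [h1 h2]. destruct (h v u (conj h2 h1)) as [hs hc]. split.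
  - intros i j. destruct (hs j i). now split.
  - intros i j. rewrite (Nat.add_comm i j). apply hc.
Qed.

(** Exchanging the variables exchanges the two terms of L, and thus turns L into -L. *)
Lemma iter_L_op_swap (g : R -> R -> R) (n : nat) : forall x y,
  Nat.iter n L_op (swap g) x y = (- 1) ^ n * Nat.iter n L_op g y x.
Proof.
  induction n as [|n IH]; intros x y; [simpl; unfold swap; ring|].
  change (L_op (Nat.iter n L_op (swap g)) x y
    = (- 1) ^ S n * L_op (Nat.iter n L_op g) y x).
  set (G := Nat.iter n L_op g) in *. unfold L_op at 1.
  rewrite (Derive_ext _ (fun u => (- 1) ^ n * G y u)) by (intros; apply IH).
  rewrite (Derive_ext (fun v => _ x v) (fun v => (- 1) ^ n * G v x)) by (intros; apply IH).
  rewrite !Derive_scal. unfold L_op. simpl pow.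
  change (Derive (fun v => G y v) x) with (Derive (G y) x). ring.
Qed.

Lemma exp_L_term_swap (phi : R) (g : R -> R -> R) (x y : R) (n : nat) :
  exp_L_term (- phi) (swap g) y x n = exp_L_term phi g x y n.
Proof.
  unfold exp_L_term. rewrite iter_L_op_swap.
  replace (- phi) with ((- 1) * phi) by ring. rewrite Rpow_mult_distr.
  assert (e : (- 1) ^ n * (- 1) ^ n = 1).
  { rewrite <- Rpow_mult_distr. replace (- 1 * - 1) with 1 by ring. apply pow1. }
  transitivity ((- 1) ^ n * (- 1) ^ n * (phi ^ n / INR (fact n) * Nat.iter n L_op g x y)).
  - unfold Rdiv. ring.
  - rewrite e. ring.
Qed.

Lemma exp_L_swap (phi : R) (g : R -> R -> R) (x y : R) :
  exp_L (- phi) (swap g) y x = exp_L phi g x y.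
Proof. apply Series_ext, exp_L_term_swap. Qed.

Lemma ex_exp_L_swap (phi : R) (g : R -> R -> R) (x y : R) :
  ex_exp_L (- phi) (swap g) y x <-> ex_exp_L phi g x y.
Proof.
  split; apply ex_series_ext; intros n; [|symmetry]; apply exp_L_term_swap.
Qed.

Lemma rot_x_swap (phi x y : R) : rot_x (- phi) y x = rot_y phi x y.
Proof. unfold rot_x, rot_y. rewrite cos_neg, sin_neg. ring. Qed.

Lemma rot_y_swap (phi x y : R) : rot_y (- phi) y x = rot_x phi x y.
Proof. unfold rot_x, rot_y. rewrite cos_neg, sin_neg. ring. Qed.

Lemma transform_converges_swap (phi : R) (f : R -> R -> R) (x' y' : R) :
  transform_converges_x (- phi) (swap f) y' x' <-> transform_converges_y phi f x' y'.
Proof.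
  split; intros h s hs; generalize (h s hs); apply filter_imp; intros Y;
    unfold transform_converges;
    rewrite (rot_x_swap (- phi) x' Y), (rot_y_swap (- phi) x' Y); apply ex_exp_L_swap.
Qed.

(** By conversion [Dfrac_y] of [F] at a point is [Dfrac_x] of [swap F] at the reflected point, so
    this is the law in x for the angle -phi. *)
Lemma Dfrac_y_rotation (kd : frac_kind) (alpha : R) (f F : R -> R -> R) (phi x y : R) :
  0 < alpha ->
  (forall X Y, F X Y = exp_L phi f (rot_x (- phi) X Y) (rot_y (- phi) X Y)) ->
  (forall t, 0 <= t <= 1 -> 0 < rot_y (t * phi) x y) ->
  rotation_domain_y (regular_dom f) phi x y ->
  transform_converges_y phi f (rot_x phi x y) (rot_y phi x y) ->
  ex_exp_L phi (Dfrac_y kd alpha f) x y ->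
  Dfrac_y kd alpha F (rot_x phi x y) (rot_y phi x y) = exp_L phi (Dfrac_y kd alpha f) x y.
Proof.
  intros ha hF hpos hdom hconv hex.
  assert (et : forall t, t * - phi = - (t * phi)) by (intros; ring).
  assert (h := Dfrac_x_rotation kd alpha (swap f) (swap F) (- phi) y x ha).
  rewrite rot_x_swap, rot_y_swap in h.
  rewrite <- exp_L_swap. apply h; clear h.
  - intros X Y. rewrite (rot_x_swap (- phi) Y X), (rot_y_swap (- phi) Y X), exp_L_swap. apply hF.
  - intros t ht. rewrite et, rot_x_swap. auto.
  - intros s t hs ht. destruct (hdom s t hs ht) as [h1 h2]. rewrite !et, !rot_x_swap, !rot_y_swap.
    split; [now apply regular_swap|].
    cbv zeta in h2 |- *. rewrite (rot_x_swap (- (t * phi)) (rot_x phi x y)),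
      (rot_y_swap (- (t * phi)) (rot_x phi x y)). now apply regular_swap.
  - now apply transform_converges_swap.
  - now apply ex_exp_L_swap in hex.
Qed.

Lemma Dfrac_y_small_rotation (kd : frac_kind) (alpha : R) (f : R -> R -> R)
    (f' : R -> R -> R -> R) (x y : R) :
  0 < alpha -> 0 < x -> 0 < y ->
  (forall phi X Y, f' phi X Y = exp_L phi f (rot_x (- phi) X Y) (rot_y (- phi) X Y)) ->
  (forall s, 0 <= s <= 1 -> regular f x (s * y)) ->
  exists (delta : posreal) (C : R), forall phi, Rabs phi < delta ->
    transform_converges_y phi f (rot_x phi x y) (rot_y phi x y) /\
    ex_exp_L phi (Dfrac_y kd alpha f) x y /\
    Dfrac_y kd alpha (f' phi) (rot_x phi x y) (rot_y phi x y)
      = exp_L phi (Dfrac_y kd alpha f) x y /\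
    Rabs (Dfrac_y kd alpha (f' phi) (rot_x phi x y) (rot_y phi x y)
          - (Dfrac_y kd alpha f x y + phi * L_op (Dfrac_y kd alpha f) x y)) <= C * phi ^ 2.
Proof.
  intros ha hx hy hf' hseg.
  (* Rotating [swap f] by psi reflects the rotation of [f] by -psi, hence the sign in the index of
     [f']. *)
  destruct (Dfrac_x_small_rotation kd alpha (swap f) (fun psi => swap (f' (- psi))) y x ha hy hx)
    as [delta [C h]].
  { intros psi X Y. rewrite <- (exp_L_swap psi). change (swap (swap f)) with f.
    rewrite (rot_x_swap psi Y X), (rot_y_swap psi Y X).
    rewrite <- (Ropp_involutive psi) at 3 4. apply hf'. }
  { intros s hs. now apply regular_swap, hseg. }
  exists delta, C. intros phi hphi.
  destruct (h (- phi)) as [h1 [h2 [h3 h4]]]; [now rewrite Rabs_Ropp|].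
  rewrite rot_x_swap, rot_y_swap, Ropp_involutive in *.
  split; [now apply transform_converges_swap|].
  split; [now apply ex_exp_L_swap|].
  split; [rewrite <- exp_L_swap; exact h3|].
  assert (e : L_op (Dfrac_x kd alpha (swap f)) y x = - L_op (Dfrac_y kd alpha f) x y).
  { change (L_op (Dfrac_x kd alpha (swap f)) y x)
      with (Nat.iter 1 L_op (swap (Dfrac_y kd alpha f)) y x).
    rewrite iter_L_op_swap. simpl. ring. }
  rewrite e in h4. replace ((- phi) ^ 2) with (phi ^ 2) in h4 by ring.
  replace (- phi * - L_op (Dfrac_y kd alpha f) x y)
    with (phi * L_op (Dfrac_y kd alpha f) x y) in h4 by ring.
  exact h4.
Qed.

(** For negative phi, [tan phi < y / x] does not imply x' > 0, hence the condition
    [0 < rot_x phi x y]; positivity of y' does follow from the tangent, as cos phi > 0. *)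
Theorem mainTheorem2 (kd : frac_kind) (alpha : R) (U : R * R -> Prop)
    (f : R -> R -> R) (f' : R -> R -> R -> R)
    (halpha : 0 < alpha)
    (hU : open U)
    (hf : forall x y : R, U (x, y) -> analytic_at f x y)
    (hf' : forall phi x y : R,
       f' phi (rot_x phi x y) (rot_y phi x y) = exp_L phi f x y) :
  (* finite angle, wherever the exponential series converge *)
  (forall phi x y : R,
     - (PI / 2) < phi < PI / 2 ->
     0 < x -> 0 < y -> tan phi < y / x -> 0 < rot_x phi x y ->
     (rotation_domain_x U phi x y ->
      transform_converges_x phi f (rot_x phi x y) (rot_y phi x y) ->
      ex_exp_L phi (Dfrac_x kd alpha f) x y ->
      Dfrac_x kd alpha (f' phi) (rot_x phi x y) (rot_y phi x y)
        = exp_L phi (Dfrac_x kd alpha f) x y) /\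
     (rotation_domain_y U phi x y ->
      transform_converges_y phi f (rot_x phi x y) (rot_y phi x y) ->
      ex_exp_L phi (Dfrac_y kd alpha f) x y ->
      Dfrac_y kd alpha (f' phi) (rot_x phi x y) (rot_y phi x y)
        = exp_L phi (Dfrac_y kd alpha f) x y)) /\
  (* the series do converge, hence the law holds, for all small angles *)
  (forall x y : R, 0 < x -> 0 < y ->
     ((forall s : R, 0 <= s <= 1 -> U (s * x, y)) ->
      exists delta : posreal, forall phi : R, Rabs phi < delta ->
        transform_converges_x phi f (rot_x phi x y) (rot_y phi x y) /\
        ex_exp_L phi (Dfrac_x kd alpha f) x y /\
        Dfrac_x kd alpha (f' phi) (rot_x phi x y) (rot_y phi x y)
          = exp_L phi (Dfrac_x kd alpha f) x y) /\
     ((forall s : R, 0 <= s <= 1 -> U (x, s * y)) ->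
      exists delta : posreal, forall phi : R, Rabs phi < delta ->
        transform_converges_y phi f (rot_x phi x y) (rot_y phi x y) /\
        ex_exp_L phi (Dfrac_y kd alpha f) x y /\
        Dfrac_y kd alpha (f' phi) (rot_x phi x y) (rot_y phi x y)
          = exp_L phi (Dfrac_y kd alpha f) x y)) /\
  (* infinitesimal angle: equality up to terms of second order in phi *)
  (forall x y : R, 0 < x -> 0 < y ->
     ((forall s : R, 0 <= s <= 1 -> U (s * x, y)) ->
      exists (delta : posreal) (C : R), forall phi : R, Rabs phi < delta ->
        Rabs (Dfrac_x kd alpha (f' phi) (rot_x phi x y) (rot_y phi x y)
              - (Dfrac_x kd alpha f x y + phi * L_op (Dfrac_x kd alpha f) x y))
          <= C * phi ^ 2) /\
     ((forall s : R, 0 <= s <= 1 -> U (x, s * y)) ->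
      exists (delta : posreal) (C : R), forall phi : R, Rabs phi < delta ->
        Rabs (Dfrac_y kd alpha (f' phi) (rot_x phi x y) (rot_y phi x y)
              - (Dfrac_y kd alpha f x y + phi * L_op (Dfrac_y kd alpha f) x y))
          <= C * phi ^ 2)).
Proof.
  assert (hreg : forall x y, U (x, y) -> regular f x y).
  { intros x y h. now apply analytic_at_regular, hf. }
  (* [hf'] prescribes [f'] at rotated points only; every (X, Y) is one, being the rotation of its
     own rotation by -phi. *)
  assert (hF : forall phi X Y,
    f' phi X Y = exp_L phi f (rot_x (- phi) X Y) (rot_y (- phi) X Y)).
  { intros phi X Y. rewrite <- hf'. now rewrite rot_x_neg_rot, rot_y_neg_rot. }
  split; [|split].
  - intros phi x y hphi hx hy htan hx'. split; intros hdom hconv hex.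
    + apply Dfrac_x_rotation; auto.
      * intros t ht. now apply rot_x_pos_between.
      * intros s t hs ht. destruct (hdom s t hs ht). now split; apply hreg.
    + apply Dfrac_y_rotation; auto.
      (* Positivity of y' along the arc is that of the first coordinate after reflection, for the
         angle -phi. At the end point it is the inequality on tan phi multiplied by x cos phi >
         0. *)
      * intros t ht. rewrite <- rot_x_swap, Ropp_mult_distr_r.
        apply rot_x_pos_between; try easy; [lra|].
        rewrite rot_x_swap. unfold rot_y.
        assert (hc : 0 < cos phi) by (apply cos_gt_0; lra).
        assert (k : tan phi * (x * cos phi) < y / x * (x * cos phi)).
        { apply Rmult_lt_compat_r; [now apply Rmult_lt_0_compat|easy]. }
        unfold tan in k.
        replace (sin phi / cos phi * (x * cos phi)) with (sin phi * x) in k by (field; lra).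
        replace (y / x * (x * cos phi)) with (cos phi * y) in k by (field; lra). lra.
      * intros s t hs ht. destruct (hdom s t hs ht). now split; apply hreg.
  - intros x y hx hy. split; intros hseg.
    + destruct (Dfrac_x_small_rotation kd alpha f f' x y) as [delta [C h]]; auto.
      exists delta. intros phi hphi. destruct (h phi hphi) as [h1 [h2 [h3 _]]]. auto.
    + destruct (Dfrac_y_small_rotation kd alpha f f' x y) as [delta [C h]]; auto.
      exists delta. intros phi hphi. destruct (h phi hphi) as [h1 [h2 [h3 _]]]. auto.
  - intros x y hx hy. split; intros hseg.
    + destruct (Dfrac_x_small_rotation kd alpha f f' x y) as [delta [C h]]; auto.
      exists delta, C. intros phi hphi. now apply h.
    + destruct (Dfrac_y_small_rotation kd alpha f f' x y) as [delta [C h]]; auto.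
      exists delta, C. intros phi hphi. now apply h.
Qed.
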